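(* Let $k$ be a field with algebraic closure $\overline{k}$, let $d\in\mathbb{N}$, and let $f\in k\langle x_1,\dots,x_d\rangle\setminus k$. The following are equivalent: (i) $f-\lambda$ factors in $\overline{k}\langle x_1,\dots,x_d\rangle$ for infinitely many $\lambda\in\overline{k}$; (ii) $f-\lambda$ factors in $\overline{k}\langle x_1,\dots,x_d\rangle$ for all $\lambda\in\overline{k}$; (iii) the centralizer of $f$ in $k\langle x_1,\dots,x_d\rangle$ is strictly larger than $k[f]$; (iv) $f$ is composite over $k$.
   Context: For a field $K$, $K\langle x_1,\dots,x_d\rangle$ denotes the free associative (unital) $K$-algebra in freely noncommuting variables $x_1,\dots,x_d$. An element $g\in K\langle x_1,\dots,x_d\rangle$ factors in $K\langle x_1,\dots,x_d\rangle$ if $g=g_1g_2$ for some nonconstant $g_1,g_2\in K\langle x_1,\dots,x_d\rangle$. A nonconstant $f\in k\langle x_1,\dots,x_d\rangle$ is composite over $k$ if there exist $h\in k\langle x_1,\dots,x_d\rangle$ and a univariate polynomial $p\in k[t]$ with $\deg p>1$ such that $f=p(h)$. $k[f]$ is the unital $k$-subalgebra generated by $f$. *)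

(* Defs.v *)
From HB Require Import structures.
From mathcomp Require Import all_boot all_algebra.
From mathcomp Require Import finmap.
From mathcomp Require Import boolp classical_sets cardinality.
From mathcomp Require Import monalg.

Set Implicit Arguments.
Unset Strict Implicit.
Unset Printing Implicit Defensive.

Import GRing.Theory.

Local Open Scope classical_set_scope.
Local Open Scope ring_scope.

(* K<x_1, ..., x_d>: the monoid algebra over K of the free monoid of words in
   the letters 'I_d. *)
Notation freealg K d := {malg K[{fmonom 'I_d}]}.

Section FreeAlgebra.
Variables (K : fieldType) (d : nat).
Implicit Types (f g h : freealg K d) (p : {poly K}).

Definition nonconstant g := ~ (exists c : K, g = c%:MP).

Definition factors g :=
  exists g1 g2, [/\ nonconstant g1, nonconstant g2 & g = g1 * g2].

(* p(h) is spelled out because [horner_alg] requires an [algType], and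
   {malg K[M]} is only declared as one when M is commutative. *)
Definition composite f :=
  exists h p, (2 < size p)%N /\ f = (map_poly (in_alg (freealg K d)) p).[h].

Definition generated_subalg f : set (freealg K d) :=
  smallest [set S : set (freealg K d) | GRing.subalg_closed (mem S)] [set f].

Definition centralizer f : set (freealg K d) := [set g | GRing.comm f g].

End FreeAlgebra.

Definition map_malg (K L : fieldType) (d : nat) (iota : {rmorphism K -> L})
    (f : freealg K d) : freealg L d :=
  [malg m in msupp f => iota f@_m].

Lemma mcoeff_map_malg (K L : fieldType) (d : nat) (iota : {rmorphism K -> L})
    (f : freealg K d) m :
  (map_malg iota f)@_m = iota f@_m.
Proof. by rewrite mcoeffE; case: msuppP; rewrite ?rmorph0. Qed.

(* When L is algebraically closed, this says that iota makes L an algebraic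
   closure of K. *)
Definition algebraic_extension (K L : fieldType) (iota : {rmorphism K -> L}) :=
  forall x : L, algebraicOver iota x.

(* Main.v *)
(* A factorization of f - t yields a proper subspace, stable under d operators
   depending linearly on t, of the finite-dimensional space spanned by the
   transductions of f.  Over k(t), Gauss' lemma makes f - t irreducible, and
   conversely a proper stable subspace would factor f - t; so the operators act
   irreducibly.  If only scalars commuted with them, by Jacobson density their
   products would span all matrices, over k(t) and hence at all but finitely many
   t = lambda, where f - lambda would be irreducible.  So (i) gives a nonscalar
   e with (f - t) e = e' (f - t); clearing denominators and putting t = f turns
   e into an element outside k[f] that commutes with f.

   For (iii) => (iv) (Bergman's centralizer theorem), order the words by the
   slope of their periodic expansions in some base.  The leading face phi is
   multiplicative, and injective on the elements commuting with f and g.  The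
   left gcd D of f - phi(f) and g - phi(g) over k(tau), given by the weak
   algorithm, is thus not constant.  Its coefficients in tau must be scalars
   except for the lowest one, so D = H(tau) - h, and dividing phi(f) by H shows
   that f is a polynomial in h; so is g.

   For (iv) => (ii), split off a root of p - lambda from f - lambda =
   (p - lambda)(h). *)

From HB Require Import structures.
Require Import Defs.
From mathcomp Require Import all_boot all_order all_algebra.
From mathcomp Require Import finmap.
From mathcomp Require Import boolp classical_sets cardinality.
From mathcomp Require Import monalg.
From mathcomp Require Import ring.
Set Implicit Arguments.
Unset Strict Implicit.
Unset Printing Implicit Defensive.

Import Order.TTheory GRing.Theory Num.Theory.

Local Open Scope ring_scope.

(** * Free algebras *)

(** Irreducibility of f - t over k(t) need not survive the specialization t = lambda (take f = x^2),
    but the spanning of all matrices by words does, away from the zeros of finitely many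
    denominators. The obstruction thus lies in the endomorphisms of A / A (f - t), and e is the
    image of 1 under a nonscalar one. This module may be infinite-dimensional; the span V of the
    transductions of f can replace it because long enough shifts carry a given element into V and
    annihilate a given multiple of f - t. Here the constant term - t of f - t must be invertible,
    whence the normalization [eps f = 0] and the exclusion of t = 0.

    In Bergman's theorem phi embeds a commutative algebra containing f and g into k[tau], and D is
    the equation of a common eigenvector: modulo the left multiples of D, f and g act on 1 as phi(f)
    and phi(g).

    The cycle closes with (ii) => (i), an algebraically closed field being infinite. *)

(* The free algebra, presented by the transductions trans i, with
   g = eps g + \sum_i x_i (trans i g).  The carrier is kept abstract because
   {malg R[{fmonom 'I_d}]} is not declared as an algType. *)
HB.mixin Record Algebra_isFree (R : comNzRingType) (d : nat) A
    of GRing.NzRing A & GRing.Algebra R A := {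
  letter : 'I_d -> A;
  eps : A -> R;
  trans : 'I_d -> A -> A;
  eps_is_linear : linear_for *%R eps;
  eps_is_multiplicative : monoid_morphism eps;
  trans_is_linear : forall i, linear (trans i);
  eps_letter : forall i, eps (letter i) = 0;
  trans_letter : forall i j, trans i (letter j) = (j == i)%:R;
  transM : forall i g h, trans i (g * h) = trans i g * h + eps g *: trans i h;
  trans_decomp : forall g, g = (eps g)%:A + \sum_i letter i * trans i g;
  trans_nilpotent : forall g, exists N,
    forall w, (N <= size w)%N -> foldl (fun y i => trans i y) g w = 0
}.

#[short(type="freeAlgType")]
HB.structure Definition FreeAlgebra (R : comNzRingType) (d : nat) :=
  {A of Algebra_isFree R d A & GRing.NzRing A & GRing.Algebra R A}.

Bind Scope ring_scope with FreeAlgebra.sort.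

HB.instance Definition _ (R : comNzRingType) (d : nat) (A : freeAlgType R d) :=
  GRing.isLinear.Build R A R *%R (@eps R d A) (@eps_is_linear R d A).
HB.instance Definition _ (R : comNzRingType) (d : nat) (A : freeAlgType R d) :=
  GRing.isMonoidMorphism.Build A R (@eps R d A) (@eps_is_multiplicative R d A).
HB.instance Definition _ (R : comNzRingType) (d : nat) (A : freeAlgType R d) i :=
  GRing.isLinear.Build R A A *:%R (@trans R d A i) (@trans_is_linear R d A i).

Section Basics.
Variables (R : comNzRingType) (d : nat) (A : freeAlgType R d).
Implicit Types (g h : A) (i j : 'I_d) (w : seq 'I_d) (c : R).

Definition transw w g := foldl (fun y i => trans i y) g w.

Fact transw_is_linear w : linear (transw w).
Proof. by elim: w => //= i w IHw c g h; rewrite /transw /= linearP; apply: IHw. Qed.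
HB.instance Definition _ w := GRing.isLinear.Build R A A *:%R (transw w) (transw_is_linear w).

Definition wcoef w g : R := eps (transw w g).
HB.instance Definition _ w := GRing.Linear.copy (wcoef w) (@eps R d A \o transw w).

Lemma transw_cat w w' g : transw (w ++ w') g = transw w' (transw w g).
Proof. exact: foldl_cat. Qed.

Lemma wcoef_cons i w g : wcoef (i :: w) g = wcoef w (trans i g). Proof. by []. Qed.

Lemma epsZ c g : eps (c *: g) = c * eps g. Proof. exact: linearZ. Qed.
Lemma epsC c : eps (c%:A : A) = c. Proof. by rewrite epsZ rmorph1 mulr1. Qed.

Lemma trans1 i : trans i (1 : A) = 0.
Proof.
have /eqP := transM i (1 : A) 1.
by rewrite rmorph1 scale1r !mulr1 addrC -subr_eq subrr eq_sym => /eqP.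
Qed.

Lemma transC i c : trans i (c%:A : A) = 0.
Proof. by rewrite linearZ /= trans1 scaler0. Qed.

Lemma epsXM i g : eps (letter i * g) = 0.
Proof. by rewrite rmorphM /= eps_letter mul0r. Qed.

Lemma transXM i j g : trans i (letter j * g) = g *+ (j == i).
Proof. by rewrite transM eps_letter scale0r addr0 trans_letter mulr_natl. Qed.

Lemma trans_decompM g h : g * h = eps g *: h + \sum_i letter i * (trans i g * h).
Proof.
rewrite [in LHS](trans_decomp g) mulrDl mulr_suml mulr_algl.
by under eq_bigr do rewrite -mulrA.
Qed.

(** Testing only the words of length exactly N makes the bound decidable, as [ex_minn] requires; a
    longer word has such a word as a prefix. *)
Definition dg_bound g N := [forall w : N.-tuple 'I_d, transw w g == 0].

Fact dg_exists g : exists N, dg_bound g N.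
Proof.
have [N H] := trans_nilpotent g; exists N; apply/forallP => w.
by apply/eqP/H; rewrite size_tuple.
Qed.

(* One more than the degree of g, and 0 for g = 0. *)
Definition dg g : nat := ex_minn (dg_exists g).

Lemma dg_leP g N : reflect (forall w, (N <= size w)%N -> transw w g = 0) (dg g <= N)%N.
Proof.
rewrite /dg; case: ex_minnP => n /forallP Hn minn; apply: (iffP idP) => [le w lew|H].
  have sz : size (take n w) == n by rewrite size_take_min (minn_idPl _) // (leq_trans le).
  rewrite -(cat_take_drop n w) transw_cat.
  by have /eqP -> := Hn (Tuple sz); rewrite linear0.
by apply: minn; apply/forallP => w; apply/eqP/H; rewrite size_tuple.
Qed.

Lemma transw_dg g w : (dg g <= size w)%N -> transw w g = 0.
Proof. by move=> le; apply: (elimT (dg_leP g _) le). Qed.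

Lemma wcoef_dg g w : (dg g <= size w)%N -> wcoef w g = 0.
Proof. by move=> le; rewrite /wcoef transw_dg ?rmorph0. Qed.

Lemma dg_eq0 g : (dg g == 0)%N = (g == 0).
Proof.
apply/idP/eqP => [|->]; last by rewrite -leqn0; apply/dg_leP => w _; rewrite linear0.
by rewrite -leqn0 => /dg_leP /(_ [::] isT).
Qed.

Lemma dg0 : dg (0 : A) = 0%N. Proof. by apply/eqP; rewrite dg_eq0. Qed.

Lemma dg_gt0 g : g != 0 -> (0 < dg g)%N.
Proof. by rewrite lt0n dg_eq0. Qed.

Lemma dg_leS g N : (dg g <= N.+1)%N <-> forall i, (dg (trans i g) <= N)%N.
Proof.
split=> [/dg_leP H i|H]; first by apply/dg_leP => w le; apply: (H (i :: w)).
by apply/dg_leP => -[|i w] //= le; apply: (elimT (dg_leP _ _) (H i)).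
Qed.

Lemma dg_trans N i g : (dg g <= N.+1)%N -> (dg (trans i g) <= N)%N.
Proof. by move/dg_leS. Qed.

Lemma dgC c : (dg (c%:A : A) <= 1)%N.
Proof. by apply/dg_leS => i; rewrite transC dg0. Qed.

Lemma dgD N g h : (dg g <= N)%N -> (dg h <= N)%N -> (dg (g + h) <= N)%N.
Proof.
move=> lg lh; apply/dg_leP => w le.
by rewrite linearD /= !transw_dg ?addr0 ?(leq_trans _ le).
Qed.

Lemma dgZ N c g : (dg g <= N)%N -> (dg (c *: g) <= N)%N.
Proof.
by move=> lg; apply/dg_leP => w le; rewrite linearZ /= transw_dg ?scaler0 ?(leq_trans _ le).
Qed.

Lemma dgN N g : (dg g <= N)%N -> (dg (- g) <= N)%N.
Proof. by rewrite -scaleN1r; apply: dgZ. Qed.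

Lemma dgB N g h : (dg g <= N)%N -> (dg h <= N)%N -> (dg (g - h) <= N)%N.
Proof. by move=> lg lh; apply: dgD => //; apply: dgN. Qed.

Lemma dg_sum (I : Type) (r : seq I) (P : pred I) (F : I -> A) N :
  (forall x, P x -> (dg (F x) <= N)%N) -> (dg (\sum_(x <- r | P x) F x) <= N)%N.
Proof.
by move=> H; elim/big_ind: _ => // [|g h]; [rewrite dg0|apply: dgD].
Qed.

Lemma dg_le1 g : (dg g <= 1)%N -> g = (eps g)%:A.
Proof.
move=> le; rewrite {1}(trans_decomp g) big1 ?addr0 // => i _.
by have := dg_trans i le; rewrite leqn0 dg_eq0 => /eqP->; rewrite mulr0.
Qed.

Lemma dg_top g : g != 0 -> exists w, wcoef w g != 0 /\ dg g = (size w).+1.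
Proof.
elim: {g}(dg g) {-2}g (erefl (dg g)) => [|N IHN] g dgE g0.
  by move: g0; rewrite -dg_eq0 dgE.
have [e|[i ti]] : (dg g <= 1)%N \/ exists i, dg (trans i g) = N /\ trans i g != 0.
- case: (leqP (dg g) 1) => [|lt1]; [by left|right].
  have [[i]|H] := pselect (exists i, (dg (trans i g) >= N)%N).
    move=> le; have e : dg (trans i g) = N.
      by apply/eqP; rewrite eqn_leq le andbT; apply: dg_trans; rewrite dgE.
    by exists i; rewrite -dg_eq0 e; split=> //; move: lt1; rewrite dgE; case: (N).
  have : (dg g <= N)%N.
    case: N {IHN} dgE H lt1 => [->|N' dgE H _] //.
    by apply/dg_leS => i; rewrite -ltnS ltnNge; apply/negP => le; case: H; exists i.
  by rewrite dgE ltnn.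
- exists [::]; split; last by rewrite dgE; move: e; rewrite dgE; case: (N).
  by rewrite /wcoef /=; apply: contra_neq g0 => eg; rewrite (dg_le1 e) eg scale0r.
- have [w [cw e]] := IHN _ ti.1 ti.2.
  by exists (i :: w); split=> //=; rewrite dgE -e ti.1.
Qed.

Lemma eq_wcoef g h : (forall w, wcoef w g = wcoef w h) -> g = h.
Proof.
move=> H; apply/eqP; rewrite -subr_eq0; apply/contraT => /dg_top[w [/eqP[]]].
by rewrite linearB /= H subrr.
Qed.

Lemma wcoef_nil g : wcoef [::] g = eps g. Proof. by []. Qed.

Lemma mulr_wcoef g h w :
  wcoef w (g * h) = \sum_(0 <= k < (size w).+1) wcoef (take k w) g * wcoef (drop k w) h.
Proof.
elim: w g => [|i w IHw] g /=.
  by rewrite big_nat1 /wcoef /= rmorphM.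
rewrite wcoef_cons transM linearD linearZ /= IHw addrC.
by rewrite [RHS]big_nat_recl //= /wcoef /=.
Qed.

Lemma wcoefM_top g h w w' :
  (dg g <= (size w).+1)%N -> (dg h <= (size w').+1)%N ->
  wcoef (w ++ w') (g * h) = wcoef w g * wcoef w' h.
Proof.
move=> lg lh; rewrite mulr_wcoef big_mkord (bigD1 (inord (size w))) //=.
have sw : (size w < (size (w ++ w')).+1)%N by rewrite ltnS size_cat leq_addr.
rewrite inordK // take_size_cat // drop_size_cat // big1 ?addr0 // => l.
rewrite -val_eqE /= inordK // => lw; have := ltn_ord l; rewrite ltnS => lww.
have [lt|lt|e] := ltngtP l (size w); last by rewrite e eqxx in lw.
  rewrite [X in _ * X]wcoef_dg ?mulr0 // (leq_trans lh) //.
  by move: (nat_of_ord l) lt => m lt; rewrite size_drop size_cat ltn_subRL ltn_add2r.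
by rewrite wcoef_dg ?mul0r // (leq_trans lg) // size_take_min (minn_idPl _).
Qed.

Lemma dgM N N' g h : (dg g <= N.+1)%N -> (dg h <= N')%N -> (dg (g * h) <= N + N')%N.
Proof.
elim: N g => [|N IHN] g lg lh.
  by rewrite (dg_le1 lg) mulr_algl dgZ.
rewrite addSn; apply/dg_leS => i; rewrite transM dgD ?IHN ?dg_trans // dgZ //.
case: N' {IHN} lh => [|N']; first by rewrite leqn0 dg_eq0 => /eqP->; rewrite linear0 dg0.
move=> lh; apply: leq_trans (leq_addl N N'.+1).
exact: leq_trans (dg_trans i lh) (leqnSn _).
Qed.

End Basics.

Section Domain.
Variables (R : idomainType) (d : nat) (A : freeAlgType R d).
Implicit Types (g h : A).

Lemma fmulf_eq0 g h : (g * h == 0) = (g == 0) || (h == 0).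
Proof.
have [->|g0] := eqVneq g 0; first by rewrite mul0r eqxx.
have [->|h0] := eqVneq h 0; first by rewrite mulr0 eqxx.
apply/negbTE; have [w [gw lg]] := dg_top g0; have [w' [hw lh]] := dg_top h0.
apply: contraNneq (mulf_neq0 gw hw) => gh0.
by rewrite -wcoefM_top ?lg ?lh // gh0 linear0.
Qed.

Lemma fmulf_neq0 g h : g != 0 -> h != 0 -> g * h != 0.
Proof. by move=> g0 h0; rewrite fmulf_eq0 negb_or g0. Qed.

Lemma fmulIf h : h != 0 -> injective (fun g => g * h).
Proof.
move=> h0 g g' /eqP; rewrite -subr_eq0 -mulrBl fmulf_eq0 (negbTE h0) orbF.
by rewrite subr_eq0 => /eqP.
Qed.

Lemma fscale_eq0 (c : R) g : (c *: g == 0) = (c == 0) || (g == 0).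
Proof.
rewrite -mulr_algl fmulf_eq0; congr (_ || _).
by apply/eqP/eqP => [/(congr1 (@eps _ _ _))|->]; rewrite ?scale0r ?epsC ?rmorph0.
Qed.

Lemma dgM_eq g h : g != 0 -> h != 0 -> dg (g * h) = ((dg g).-1 + dg h)%N.
Proof.
move=> g0 h0; apply/eqP; rewrite eqn_leq dgM ?prednK ?dg_gt0 //=.
have [w [gw lg]] := dg_top g0; have [w' [hw lh]] := dg_top h0.
rewrite lg lh /= addnS ltnNge; apply: contra (mulf_neq0 gw hw) => le.
by rewrite -wcoefM_top ?lg ?lh // wcoef_dg // size_cat.
Qed.

Lemma dg_unit g h : g * h = 1 -> dg g = 1%N /\ dg h = 1%N.
Proof.
move=> gh; have g0 : g != 0 by apply: contra_eq_neq gh => ->; rewrite mul0r eq_sym oner_eq0.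
have h0 : h != 0 by apply: contra_eq_neq gh => ->; rewrite mulr0 eq_sym oner_eq0.
have := dgC A 1; rewrite scale1r -gh dgM_eq //.
move: (dg_gt0 g0) (dg_gt0 h0).
by case: (dg g) (dg h) => [|[|a]] [|[|b]] //; rewrite /= ?addnS.
Qed.

End Domain.

(** * The weak algorithm *)

Section WeakAlgorithm.
Variables (F : fieldType) (d : nat) (A : freeAlgType F d).
Implicit Types (g h u v : A) (w : seq 'I_d).

Lemma dg_transw w g N : (dg g <= size w + N)%N -> (dg (transw w g) <= N)%N.
Proof.
move=> le; apply/dg_leP => w' lew; rewrite -transw_cat transw_dg //.
by rewrite size_cat (leq_trans le) // leq_add2l.
Qed.

(** The difference is a combination of the transductions of v by the nonempty suffixes of w,
    weighted by the coefficients of u at the complementary prefixes. Either v is already small, or a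
    prefix occurring in u is so short that the remaining suffix lowers v enough. *)
Lemma dg_transwM w u v M :
  (dg v <= M.+1)%N \/ (dg u + dg v <= size w + M.+1)%N ->
  (dg (transw w (u * v) - transw w u * v) <= M)%N.
Proof.
elim: w u => [|i w IHw] u H; first by rewrite /= subrr dg0.
have [->|u0] := eqVneq u 0.
  by rewrite mul0r linear0 mul0r subrr dg0.
have -> : transw (i :: w) (u * v) - transw (i :: w) u * v =
    (transw w (trans i u * v) - transw w (trans i u) * v)
    + eps u *: transw (i :: w) v.
  by rewrite /= -!/(transw _ _) transM linearD linearZ /= addrAC.
apply: dgD.
  apply: IHw; case: H => [|H]; [by left|right].
  rewrite -ltnS (leq_trans _ H) // -addSn leq_add2r.
  by rewrite -(prednK (dg_gt0 u0)) ltnS dg_trans // prednK ?dg_gt0.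
apply/dgZ/dg_transw; case: H => [H|]; first by rewrite (leq_trans H) //= addSnnS leq_addl.
move=> H; rewrite -ltnS -addnS (leq_trans _ H) // -add1n leq_add2r.
exact: dg_gt0.
Qed.

(* The weak algorithm: in a nontrivial relation, pick among the terms of
   maximal degree one whose left factor u_i0 has least degree, and strip a
   leading word of u_i0 from the whole relation. *)
Lemma weak_algorithm (I : finType) (u v : I -> A) (i1 : I) :
  \sum_i u i * v i = 0 -> u i1 * v i1 != 0 ->
  exists (i0 : I) (w : seq 'I_d),
    (dg (v i0 + \sum_(i | i != i0) ((wcoef w (u i0))^-1 *: transw w (u i)) * v i)
       < dg (v i0))%N.
Proof.
move=> uv0 uv1.
pose P i := u i * v i != 0; pose D i := (dg (u i) + dg (v i))%N.
have P1 : P i1 by [].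
case: (@arg_maxnP _ i1 P D P1) => i2 Pi2 maxD.
pose Q i := P i && (D i == D i2).
have Q2 : Q i2 by rewrite /Q Pi2 eqxx.
case: (@arg_minnP _ i2 Q (fun i => dg (u i)) Q2) => i0 /andP[Pi0 /eqP D0] minu.
have u0 : u i0 != 0 by apply: contraNneq Pi0 => ->; rewrite mul0r.
have v0 : v i0 != 0 by apply: contraNneq Pi0 => ->; rewrite mulr0.
have [w [cw dgu]] := dg_top u0.
have dgv := prednK (dg_gt0 v0).
have E i : (dg (transw w (u i * v i) - transw w (u i) * v i) <= (dg (v i0)).-1)%N.
  have [Pi|] := boolP (P i); last first.
    rewrite negbK fmulf_eq0 => /orP[]/eqP->.
      by rewrite mul0r linear0 mul0r subrr dg0.
    by rewrite !mulr0 linear0 subrr dg0.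
  apply: dg_transwM; rewrite dgv.
  have [le|lt] := leqP (dg (u i0)) (dg (u i)).
    left; rewrite -(leq_add2l (dg (u i0))) (leq_trans (leq_add le (leqnn _))) //.
    by have := maxD i Pi; rewrite -D0.
  (* Here u_i has smaller degree than u_i0, so by the choice of i0 the term i is not of maximal
     degree; this strictness supplies the missing unit. *)
  right; rewrite -ltnS.
  have -> : (size w + dg (v i0)).+1 = D i2 by rewrite -D0 /D dgu addSn.
  rewrite ltn_neqAle [(_ <= _)%N](maxD i Pi) andbT; apply: contraTneq lt => e; rewrite -leqNgt.
  by apply: minu; rewrite /Q Pi; apply/eqP.
exists i0, w; rewrite -dgv ltnS.
have -> : v i0 + \sum_(i | i != i0) (wcoef w (u i0))^-1 *: transw w (u i) * v i =
  - ((wcoef w (u i0))^-1 *: \sum_i (transw w (u i * v i) - transw w (u i) * v i)).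
  rewrite sumrB -linear_sum uv0 linear0 sub0r scalerN opprK.
  rewrite [in RHS](bigD1 i0) //= scalerDr scaler_sumr; congr (_ + _); last first.
    by apply: eq_bigr => i _; rewrite scalerAl.
  have /dg_le1 -> : (dg (transw w (u i0)) <= 1)%N.
    by apply: dg_transw; rewrite dgu addn1.
  by rewrite mulr_algl scalerA mulVf ?scale1r.
by apply/dgN/dgZ/dg_sum => i _.
Qed.

Section CoefficientsIn.
Variable S : F -> Prop.
Hypotheses (S1 : S 1) (SB : forall x y, S x -> S y -> S (x - y))
  (SM : forall x y, S x -> S y -> S (x * y)) (SV : forall x, S x -> S x^-1).

Definition coeffs_in g := forall w, S (wcoef w g).

Lemma coeffs_in0 : coeffs_in 0.
Proof. by move=> w; rewrite linear0 -(subrr 1); apply: SB. Qed.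

Lemma coeffs_inB g h : coeffs_in g -> coeffs_in h -> coeffs_in (g - h).
Proof. by move=> gS hS w; rewrite linearB; apply: SB; [apply: gS|apply: hS]. Qed.

Lemma coeffs_inD g h : coeffs_in g -> coeffs_in h -> coeffs_in (g + h).
Proof.
move=> gS hS; rewrite -[h]opprK; apply: coeffs_inB => //.
by rewrite -sub0r; apply: coeffs_inB => //; apply: coeffs_in0.
Qed.

Lemma coeffs_in1 : coeffs_in 1.
Proof.
by case=> [|i w]; [rewrite wcoef_nil rmorph1|rewrite wcoef_cons trans1; apply: coeffs_in0].
Qed.

Lemma coeffs_inM g h : coeffs_in g -> coeffs_in h -> coeffs_in (g * h).
Proof.
move=> gS hS w; rewrite mulr_wcoef; elim/big_ind: _ => [|x y xS yS|l _].
- by have := coeffs_in0 [::]; rewrite linear0.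
- rewrite -[y]opprK; apply: SB => //; rewrite -sub0r; apply: SB => //.
  by have := coeffs_in0 [::]; rewrite linear0.
- by apply: SM; [apply: gS|apply: hS].
Qed.

Lemma coeffs_inZ c g : S c -> coeffs_in g -> coeffs_in (c *: g).
Proof. by move=> cS gS w; rewrite linearZ; apply: SM => //; apply: gS. Qed.

Lemma coeffs_in_transw w g : coeffs_in g -> coeffs_in (transw w g).
Proof. by move=> gS w'; rewrite /wcoef -transw_cat; apply: gS. Qed.

(** Euclid's algorithm, with the weak algorithm applied to u a + v b = 0 as its division step. Only
    coefficients of u and v get inverted, so the gcd and its cofactors stay over the subfield S. *)
Lemma left_gcd_exists (a b u v : A) :
  coeffs_in a -> coeffs_in b -> coeffs_in u -> coeffs_in v ->
  u * a + v * b = 0 -> u != 0 \/ v != 0 ->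
  exists c p q x y, [/\ a = p * c, b = q * c, c = x * a + y * b &
    [/\ coeffs_in c, coeffs_in x & coeffs_in y]].
Proof.
have S0 := coeffs_in0; have S1' := coeffs_in1.
elim: {a b}(dg a + dg b)%N {-2}a {-2}b (leqnn (dg a + dg b)) u v
  => [|N IHN] a b le u v aS bS uS vS uv0 nz.
  exists b, 0, 1, 0, 1; rewrite !mul0r !mul1r add0r; split=> //.
  by apply/eqP; rewrite -dg_eq0 -leqn0 (leq_trans _ le) ?leq_addr.
have [a0|a0] := eqVneq a 0.
  by exists b, 0, 1, 0, 1; rewrite !mul0r !mul1r add0r.
have [b0|b0] := eqVneq b 0.
  by exists a, 1, 0, 1, 0; rewrite !mul0r !mul1r addr0.
have u0 : u != 0.
  case: nz => // v0; apply: contraNneq (fmulf_neq0 v0 b0) => u0.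
  by rewrite -uv0 u0 mul0r add0r.
have v0 : v != 0.
  apply: contraNneq (fmulf_neq0 u0 a0) => v0.
  by rewrite -uv0 v0 mul0r addr0.
pose s (x y : A) (i : bool) := if i then x else y.
have [||i [w]] := @weak_algorithm bool (s u v) (s a b) true.
- by rewrite big_bool.
- exact: fmulf_neq0.
pose r l := (wcoef w (s u v l))^-1.
have rS l g : coeffs_in g -> coeffs_in (r l *: transw w g).
  move=> gS; apply: coeffs_inZ; last exact: coeffs_in_transw.
  by apply: SV; case: l; [apply: uS|apply: vS].
case: i => /=; rewrite big_mkcond big_bool /= ?add0r ?addr0 => lt.
  have := rS true _ vS; move: lt; rewrite /r /=; move: (_ *: transw w v) => {}r lt {}rS.
  have [|||||||c [p [q [x [y [ea eb ec [cS xS yS]]]]]]] := IHN (a + r * b) b _ u (v - u * r) => //.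
  - by rewrite -ltnS (leq_trans _ le) // -addSn leq_add2r.
  - by apply/coeffs_inD/coeffs_inM.
  - by apply/coeffs_inB/coeffs_inM.
  - by rewrite mulrDr mulrBl mulrA addrACA subrr addr0.
  - by left.
  exists c, (p - r * q), q, x, (x * r + y); split=> //.
  - by rewrite mulrBl -ea -mulrA -eb addrK.
  - by rewrite mulrDl addrA -mulrA -mulrDr.
  - by split=> //; apply: coeffs_inD => //; apply: coeffs_inM.
have := rS false _ uS; move: lt; rewrite /r /=; move: (_ *: transw w u) => {}r lt {}rS.
have [|||||||c [p [q [x [y [ea eb ec [cS xS yS]]]]]]] := IHN a (b + r * a) _ (u - v * r) v => //.
- by rewrite -ltnS (leq_trans _ le) // -addnS leq_add2l.
- by apply/coeffs_inD/coeffs_inM.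
- by apply/coeffs_inB/coeffs_inM.
- by rewrite mulrDr mulrBl mulrA [v * b + _]addrC addrA subrK.
- by right.
exists c, p, (q - r * p), (x + y * r), y; split=> //.
- by rewrite mulrBl -eb -mulrA -ea addrK.
- by rewrite ec mulrDr mulrDl mulrA addrAC addrA.
- by split=> //; apply: coeffs_inD => //; apply: coeffs_inM.
Qed.

End CoefficientsIn.

End WeakAlgorithm.

(** * Jacobson density *)

Section WordMatrix.
Variables (R : nzRingType) (T : Type) (q : nat) (M : T -> 'M[R]_q).

Definition word_mx (w : seq T) : 'M[R]_q := foldl (fun X i => X *m M i) 1%:M w.

Lemma word_mx_rcons w i : word_mx (rcons w i) = word_mx w *m M i.
Proof. by rewrite /word_mx foldl_rcons. Qed.

End WordMatrix.

Lemma map_word_mx (R S : nzRingType) (h : {rmorphism R -> S}) (T : Type) (q : nat)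
    (M : T -> 'M[R]_q) (M' : T -> 'M[S]_q) w :
  (forall i, map_mx h (M i) = M' i) -> map_mx h (word_mx M w) = word_mx M' w.
Proof.
move=> H; elim/last_ind: w => [|w i IHw]; first by rewrite /word_mx /= map_mx1.
by rewrite !word_mx_rcons map_mxM IHw H.
Qed.

Section Density.
Variables (F : fieldType) (T : Type) (q : nat) (M : T -> 'M[F]_q).
Implicit Types (X Y : 'M[F]_q) (w : seq T).

Local Notation word_mx := (word_mx M).

Definition word_span X := exists s : seq (F * seq T),
  X = \sum_(x <- s) x.1 *: word_mx x.2.

Lemma word_span1 : word_span 1%:M.
Proof. by exists [:: (1, [::])]; rewrite big_seq1 scale1r. Qed.

Lemma word_span0 : word_span 0.
Proof. by exists [::]; rewrite big_nil. Qed.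

Lemma word_spanD X Y : word_span X -> word_span Y -> word_span (X + Y).
Proof. by move=> [s ->] [s' ->]; exists (s ++ s'); rewrite big_cat. Qed.

Lemma word_spanZ c X : word_span X -> word_span (c *: X).
Proof.
move=> [s ->]; exists [seq (c * x.1, x.2) | x <- s].
by rewrite big_map scaler_sumr; apply: eq_bigr => x _; rewrite scalerA.
Qed.

Lemma word_spanB X Y : word_span X -> word_span Y -> word_span (X - Y).
Proof. by move=> hX hY; apply: word_spanD => //; rewrite -scaleN1r; apply: word_spanZ. Qed.

Lemma word_span_sum (I : Type) (r : seq I) (G : I -> 'M[F]_q) :
  (forall x, word_span (G x)) -> word_span (\sum_(x <- r) G x).
Proof.
by move=> H; elim/big_ind: _ => //; [exact: word_span0|exact: word_spanD].
Qed.

Lemma word_span_mulM X i : word_span X -> word_span (X *m M i).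
Proof.
move=> [s ->]; exists [seq (x.1, rcons x.2 i) | x <- s].
rewrite big_map mulmx_suml; apply: eq_bigr => x _.
by rewrite word_mx_rcons -scalemxAl.
Qed.

Lemma word_span_mul X Y : word_span X -> word_span Y -> word_span (X *m Y).
Proof.
move=> hX [s ->]; rewrite mulmx_sumr; apply: word_span_sum => x.
rewrite -scalemxAr; apply: word_spanZ.
elim/last_ind: (x.2) => [|w i IHw]; first by rewrite mulmx1.
by rewrite word_mx_rcons mulmxA; apply: word_span_mulM.
Qed.

(** Among the matrices whose row space lies in P, one of maximal rank exhausts P, since a missing
    vector could be adjoined. *)
Lemma subspace_matrix (P : 'rV[F]_q -> Prop) :
  P 0 -> (forall y z, P y -> P z -> P (y + z)) -> (forall c z, P z -> P (c *: z)) ->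
  exists B : 'M[F]_q, forall z, P z <-> (z <= B)%MS.
Proof.
move=> P0 PD PZ.
pose Q n := `[< exists B : 'M[F]_q, \rank B = n /\ forall z, (z <= B)%MS -> P z >].
have exQ : exists n, Q n.
  exists 0%N; apply/asboolP; exists 0; rewrite mxrank0; split=> // z.
  by rewrite submx0 => /eqP->.
have ubQ n : Q n -> (n <= q)%N by move/asboolP => [B [<- _]]; apply: rank_leq_row.
case: (ex_maxnP exQ ubQ) => n /asboolP[B [rB HB]] maxn.
exists B => z; split=> [Pz|/HB//]; apply/contraT => zB.
have : Q (\rank (B + z)%MS).
  apply/asboolP; exists (B + z)%MS; split=> // z' /sub_addsmxP[[a b] /= ->].
  apply: PD; first by apply/HB/submxMl.
  by rewrite [b]mx11_scalar mul_scalar_mx; apply: PZ.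
move/maxn; rewrite -rB leqNgt => /negP[].
have : (B < B + z)%MS by rewrite /ltmx addsmxSl addsmx_sub submx_refl.
by rewrite ltmxErank => /andP[].
Qed.

Lemma eq_mulmx_rV m (X Y : 'M[F]_(m, q)) : (forall z : 'rV_m, z *m X = z *m Y) -> X = Y.
Proof. by move=> H; apply/row_matrixP => i; rewrite !rowE. Qed.

Hypothesis irr : forall B : 'M[F]_q, (forall i, B *m M i <= B)%MS -> B != 0 -> row_full B.
Hypothesis cent : forall Z : 'M[F]_q, (forall i, Z *m M i = M i *m Z) -> exists c, Z = c%:M.

Lemma stable_subspace_full (P : 'rV[F]_q -> Prop) (z0 : 'rV[F]_q) :
  (forall y z, P y -> P z -> P (y + z)) -> (forall c z, P z -> P (c *: z)) ->
  (forall z i, P z -> P (z *m M i)) -> P z0 -> z0 != 0 -> forall z, P z.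
Proof.
move=> PD PZ PM Pz0 z00 z; have P0 : P 0 by rewrite -(scale0r z0); apply: PZ.
have [B HB] := subspace_matrix P0 PD PZ.
apply/HB/submx_full/irr.
  move=> i; apply/row_subP => l; apply/HB; rewrite row_mul; apply: PM.
  by apply/HB/row_sub.
by apply: contraNneq z00 => B0; rewrite -submx0 -B0; apply/HB.
Qed.

(* Jacobson density, by induction on the number of rows to be killed: if no
   word combination killing B' and b moved u, then b a |-> u a would be a
   well-defined endomorphism on the space of all b a, hence a scalar. *)
Lemma word_density k (B : 'M[F]_(k, q)) (u : 'rV[F]_q) : ~~ (u <= B)%MS ->
  exists X, [/\ word_span X, B *m X = 0 & u *m X != 0].
Proof.
elim: k B u => [|k IHk] B u uB.
  exists 1%:M; split; [exact: word_span1|by rewrite mulmx1 flatmx0|].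
  by rewrite mulmx1; apply: contraNneq uB => ->; rewrite sub0mx.
rewrite -(vsubmxK (B : 'M_(1 + k, q))) in uB *.
move: (usubmx _) (dsubmx _) uB => b B' uB {B}.
apply: contrapT => H.
have {}H X : word_span X -> B' *m X = 0 -> b *m X = 0 -> u *m X = 0.
  move=> hX BX bX; apply: contrapT => uX; apply: H; exists X; split=> //.
    by apply: etrans (mul_col_mx b B' X) _; rewrite bX BX col_mx0.
  exact/eqP.
have B'B : (B' <= col_mx b B')%MS by rewrite -addsmxE addsmxSr.
have bB : (b <= col_mx b B')%MS by rewrite -addsmxE addsmxSl.
have [bB'|bB'] := boolP (b <= B')%MS.
  have [X [hX BX]] := IHk B' u (contra (fun h => submx_trans h B'B) uB).
  case/eqP; apply: H => //; case/submxP: bB' => y ->.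
  by rewrite -mulmxA BX mulmx0.
pose P z := exists X, [/\ word_span X, B' *m X = 0 & b *m X = z].
have [X0 [hX0 BX0 bX0]] := IHk B' b bB'.
have Pfull : forall z, P z.
  apply: (@stable_subspace_full P (b *m X0)) => //.
  - move=> y z [X [hX BX <-]] [Y [hY BY <-]]; exists (X + Y); split.
    + exact: word_spanD.
    + by rewrite mulmxDr BX BY addr0.
    + by rewrite mulmxDr.
  - move=> c z [X [hX BX <-]]; exists (c *: X); split.
    + exact: word_spanZ.
    + by rewrite -scalemxAr BX scaler0.
    + by rewrite -scalemxAr.
  - move=> z i [X [hX BX <-]]; exists (X *m M i); split.
    + exact: word_span_mulM.
    + by rewrite mulmxA BX mul0mx.
    + by rewrite mulmxA.
  - by exists X0.
have [a Ha] := choice (fun l => Pfull (delta_mx 0 l)).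
pose Z : 'M[F]_q := \matrix_l (u *m a l).
have ZE X : word_span X -> B' *m X = 0 -> b *m X *m Z = u *m X.
  move=> hX BX; set z := b *m X; apply/esym/eqP; rewrite -subr_eq0; apply/eqP.
  have -> : z *m Z = u *m (\sum_l z 0 l *: a l).
    rewrite mulmx_sumr mulmx_sum_row; apply: eq_bigr => l _.
    by rewrite rowK scalemxAr.
  rewrite -mulmxBr; apply: H.
  - apply: word_spanB => //; apply: word_span_sum => l; apply: word_spanZ.
    by case: (Ha l).
  - rewrite mulmxBr BX mulmx_sumr big1 ?subr0 // => l _.
    by rewrite -scalemxAr; case: (Ha l) => _ -> _; rewrite scaler0.
  - rewrite mulmxBr -/z mulmx_sumr [X in X - _]row_sum_delta.
    apply/eqP; rewrite subr_eq0; apply/eqP/eq_bigr => l _.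
    by rewrite -scalemxAr; case: (Ha l) => _ _ ->.
have [c Zc] : exists c, Z = c%:M.
  apply: cent => i; apply: eq_mulmx_rV => z; have [X [hX BX <-]] := Pfull z.
  rewrite !mulmxA ZE // -[b *m X *m M i]mulmxA ZE ?mulmxA //.
    exact: word_span_mulM.
  by rewrite BX mul0mx.
(* If u - c b is outside B', some X kills B' and moves u - c b, whereas u X = (b X) Z = c (b X). *)
have [ub|/IHk[X [hX BX]]] := boolP (u - c *: b <= B')%MS.
  case/negP: uB; rewrite -(subrK (c *: b) u) addmx_sub ?scalemx_sub //.
  exact: submx_trans ub B'B.
by rewrite mulmxBl -ZE // Zc mul_mx_scalar -scalemxAl subrr eqxx.
Qed.

(** Each matrix unit is a product a b: density gives an a whose only nonzero row is the j-th, and by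
    irreducibility some b carries this row to the l-th unit vector. *)
Lemma word_span_full X : word_span X.
Proof.
rewrite (matrix_sum_delta X); apply: word_span_sum => j; apply: word_span_sum => l.
apply: word_spanZ.
pose B : 'M[F]_q := 1%:M - delta_mx j j.
have /word_density[a [ha Ba ua]] : ~~ ((delta_mx 0 j : 'rV_q) <= B)%MS.
  apply/negP => /submxP[y /(congr1 (mulmx^~ (delta_mx j j)))]; rewrite -mulmxA.
  rewrite mulmxBl mul1mx !mul_delta_mx subrr mulmx0.
  by move/matrixP/(_ 0 j)/eqP; rewrite !mxE !eqxx oner_eq0.
have aE : a = delta_mx j 0 *m (delta_mx (0 : 'I_1) j *m a).
  by rewrite mulmxA mul_delta_mx; apply/eqP; rewrite -subr_eq0 -{1}(mul1mx a) -mulmxBl Ba.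
have [b [hb bE]] : exists b, word_span b /\ delta_mx 0 j *m a *m b = delta_mx 0 l :> 'rV_q.
  pose P (z : 'rV_q) := exists b, word_span b /\ delta_mx 0 j *m a *m b = z.
  apply: (@stable_subspace_full P (delta_mx 0 j *m a)) => //.
  - by move=> y z [b [hb <-]] [c [hc <-]]; exists (b + c);
      rewrite mulmxDr; split=> //; apply: word_spanD.
  - by move=> c z [b [hb <-]]; exists (c *: b); rewrite -scalemxAr; split=> //; apply: word_spanZ.
  - by move=> z i [b [hb <-]]; exists (b *m M i); rewrite mulmxA; split=> //; apply: word_span_mulM.
  - by exists 1%:M; rewrite mulmx1; split=> //; apply: word_span1.
have -> : delta_mx j l = a *m b by rewrite aE -mulmxA bE mul_delta_mx.
exact: word_span_mul.
Qed.

End Density.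

(** * The module A / A (f - t) *)

Section LeftSpan.
Variables (F : fieldType) (d : nat) (A : freeAlgType F d) (I : finType).
Implicit Types (c : I -> A) (g h : A).

Definition lspan c g := exists r, g = \sum_i r i * c i.

Lemma lspan_gen c i : lspan c (c i).
Proof.
exists (fun j => (j == i)%:R); rewrite (bigD1 i) //= eqxx mul1r big1 ?addr0 //.
by move=> j /negbTE ->; rewrite mul0r.
Qed.

Lemma lspanD c g h : lspan c g -> lspan c h -> lspan c (g + h).
Proof.
move=> [r ->] [s ->]; exists (fun i => r i + s i).
by rewrite -big_split; apply: eq_bigr => i _; rewrite mulrDl.
Qed.

Lemma lspanM c g h : lspan c h -> lspan c (g * h).
Proof.
move=> [r ->]; exists (fun i => g * r i).
by rewrite mulr_sumr; apply: eq_bigr => i _; rewrite mulrA.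
Qed.

Lemma lspan_sum c (J : Type) (s : seq J) (P : pred J) (G : J -> A) :
  (forall j, P j -> lspan c (G j)) -> lspan c (\sum_(j <- s | P j) G j).
Proof.
move=> H; elim/big_ind: _ => //; last exact: lspanD.
by exists (fun=> 0); rewrite big1 // => i _; rewrite mul0r.
Qed.

Lemma lspan_sub c c' : (forall i, lspan c' (c i)) -> forall g, lspan c g -> lspan c' g.
Proof. by move=> H g [r ->]; apply: lspan_sum => i _; apply: lspanM. Qed.

(** Finitely generated left ideals are free: in a generating family of minimal total degree, a
    nontrivial relation would let the weak algorithm lower one generator. The family keeps the index
    type I and may contain zeros, hence [u i * c i = 0] in place of [u i = 0]. *)
Lemma lspan_basis (y : I -> A) : exists c : I -> A,
  (forall g, lspan y g <-> lspan c g) /\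
  (forall u, \sum_i u i * c i = 0 -> forall i, u i * c i = 0).
Proof.
pose Q n := `[< exists c, (forall g, lspan y g <-> lspan c g) /\ (\sum_i dg (c i))%N = n >].
have exQ : exists n, Q n by exists (\sum_i dg (y i))%N; apply/asboolP; exists y.
case: (ex_minnP exQ) => n /asboolP[c [cE sc]] minn.
exists c; split=> // u u0 i1; apply/eqP/contraT => ui1.
have [i0 [w]] := weak_algorithm u0 ui1; set r := fun i => (wcoef w (u i0))^-1 *: transw w (u i).
rewrite -[X in (dg X < _)%N]/(c i0 + \sum_(i | i != i0) r i * c i) => lt.
pose c' i := if i == i0 then c i0 + \sum_(j | j != i0) r j * c j else c i.
suff /minn : Q (\sum_i dg (c' i))%N.
  rewrite -sc leqNgt => /negP[].
  rewrite (bigD1 i0) // [X in (_ < X)%N](bigD1 i0) //= {1}/c' eqxx.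
  rewrite (eq_bigr (fun i => dg (c i))); last by move=> i /negbTE; rewrite /c' => ->.
  by rewrite -addSn leq_add2r.
apply/asboolP; exists c'; split=> // g; rewrite cE; split; apply: lspan_sub => i.
  have [->|ii0] := eqVneq i i0; last by have := lspan_gen c' i; rewrite {2}/c' (negbTE ii0).
  have -> : c i0 = c' i0 + \sum_(j | j != i0) - r j * c' j.
    rewrite {1}/c' eqxx -addrA -big_split big1 ?addr0 //= => j /negbTE.
    by rewrite /c' => ->; rewrite mulNr subrr.
  by apply: lspanD; [apply: lspan_gen|apply: lspan_sum => j _; apply/lspanM/lspan_gen].
rewrite /c'; case: eqP => _; last exact: lspan_gen.
by apply: lspanD; [apply: lspan_gen|apply: lspan_sum => j _; apply/lspanM/lspan_gen].
Qed.

End LeftSpan.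

(** * Shifts on the module A / A (f - t) and their matrices on V *)

Section Shift.
Variables (F : fieldType) (d : nat) (A : freeAlgType F d) (f : A) (t : F).
Implicit Types (g h u : A) (w : seq 'I_d) (i : 'I_d).

(* In the left module A / A (f - t), where f acts as t, the class of [t g] is
   that of [\sum_i letter i * shift i g]. *)
Definition shift i g : A := t *: trans i g + eps g *: trans i f.

Fact shift_is_linear i : linear (shift i).
Proof.
move=> c g h; rewrite /shift (linearP (trans i)) [eps _]raddfD /= epsZ.
by rewrite !scalerDr !scalerDl !scalerA [t * c]mulrC addrACA.
Qed.
HB.instance Definition _ i := GRing.isLinear.Build F A A *:%R (shift i) (shift_is_linear i).

Definition shiftw w g := foldl (fun y i => shift i y) g w.
Fact shiftw_is_linear w : linear (shiftw w).
Proof. by elim: w => //= i w IHw c g h; rewrite /shiftw /= linearP; apply: IHw. Qed.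
HB.instance Definition _ w := GRing.isLinear.Build F A A *:%R (shiftw w) (shiftw_is_linear w).

Lemma shiftw_cons i w g : shiftw (i :: w) g = shiftw w (shift i g). Proof. by []. Qed.

Definition fiber : A := f - t%:A.

Definition fiber_multiple g := exists u, g = u * fiber.

Hypotheses (f0 : eps f = 0) (t0 : t != 0).

Lemma eps_fiber : eps fiber = - t.
Proof. by rewrite /fiber raddfB /= f0 epsC sub0r. Qed.

Lemma trans_fiber i : trans i fiber = trans i f.
Proof. by rewrite /fiber linearB /= transC subr0. Qed.

Lemma shift_mul i g h : shift i (g * h) = t *: (trans i g * h) + eps g *: shift i h.
Proof.
rewrite /shift transM rmorphM /= !scalerDr !scalerA -addrA.
by rewrite [t * _]mulrC.
Qed.

(** The constant term - t of the fiber cancels [trans i f]. On A (f - t) the shifts are thus, up to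
    the factor t, transductions of the cofactor, and long ones vanish. *)
Lemma shift_fiber_multiple i u : shift i (u * fiber) = t *: (trans i u * fiber).
Proof.
rewrite shift_mul [shift i _]/shift trans_fiber eps_fiber scaleNr subrr.
by rewrite scaler0 addr0.
Qed.

Lemma shift1 i : shift i 1 = trans i f.
Proof. by rewrite /shift trans1 scaler0 add0r rmorph1 scale1r. Qed.

Lemma shift_decomp g : t *: g = \sum_i letter i * shift i g - eps g *: fiber.
Proof.
have -> : \sum_i letter i * shift i g =
    t *: (\sum_i letter i * trans i g) + eps g *: (\sum_i letter i * trans i f).
  rewrite !scaler_sumr -big_split; apply: eq_bigr => i _.
  by rewrite /shift mulrDr -!scalerAr.
have := trans_decomp f; rewrite f0 scale0r add0r => <-.
rewrite [in LHS](trans_decomp g) scalerDr /fiber scalerBr opprB !scalerA.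
by rewrite [t * _]mulrC -[RHS]addrA [eps g *: f + _]addrC subrK addrC.
Qed.

Lemma fiber_multipleD g h : fiber_multiple g -> fiber_multiple h -> fiber_multiple (g + h).
Proof. by move=> [u ->] [v ->]; exists (u + v); rewrite mulrDl. Qed.

Lemma fiber_multipleM g h : fiber_multiple h -> fiber_multiple (g * h).
Proof. by move=> [u ->]; exists (g * u); rewrite mulrA. Qed.

Lemma fiber_multiple_shift g : (forall i, fiber_multiple (shift i g)) -> fiber_multiple g.
Proof.
move=> H; rewrite -[g](scalerK t0) shift_decomp -mulr_algl; apply: fiber_multipleM.
rewrite -scaleNr -mulr_algl; apply: fiber_multipleD.
  elim/big_ind: _ => //; [by exists 0; rewrite mul0r|exact: fiber_multipleD|].
  by move=> i _; apply: fiber_multipleM.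
by apply: fiber_multipleM; exists 1; rewrite mul1r.
Qed.

(** Together with [shiftw_fiber_multiple], this turns membership in the left ideal A (f - t) into
    the vanishing of all long enough shifts. *)
Lemma fiber_multiple_shiftw N g :
  (forall w, size w = N -> fiber_multiple (shiftw w g)) -> fiber_multiple g.
Proof.
elim: N g => [|N IHN] g H; first exact: (H [::]).
by apply: fiber_multiple_shift => i; apply: IHN => w sw; apply: (H (i :: w)); rewrite /= sw.
Qed.

Lemma shiftw_fiber_multiple w u : (dg u <= size w)%N -> shiftw w (u * fiber) = 0.
Proof.
elim: w u => [|i w IHw] u le /=.
  by move: le; rewrite leqn0 dg_eq0 => /eqP->; rewrite mul0r.
by rewrite shift_fiber_multiple linearZ /= IHw ?scaler0 // dg_trans.
Qed.

Section Realized.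
Variables (q : nat) (v : 'I_q -> A).

Definition vec (z : 'rV[F]_q) : A := \sum_j z 0 j *: v j.

Fact vec_is_linear : linear vec.
Proof.
move=> c y z; rewrite /vec scaler_sumr -big_split; apply: eq_bigr => j _.
by rewrite !mxE scalerDl scalerA.
Qed.
HB.instance Definition _ := GRing.isLinear.Build F 'rV[F]_q A *:%R vec vec_is_linear.

Variables (N : 'I_d -> 'M[F]_q) (b : 'I_d -> 'rV[F]_q) (o : 'rV[F]_q) (wl : 'I_q -> seq 'I_d).

(* v is a basis, with dual words wl, of the span V of the transw w f for
   nonempty w; the operators trans i act on V by the matrices N i, and b i and
   o are the coordinates of trans i f and of 1. *)
Record realization : Prop := Realization {
  real_dual : forall j l, wcoef (wl l) (v j) = (j == l)%:R;
  real_span : forall j, exists s : seq (F * seq 'I_d),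
    all (fun x => x.2 != [::]) s /\ v j = \sum_(x <- s) x.1 *: transw x.2 f;
  real_trans : forall i j, trans i (v j) = vec (row j (N i));
  real_base : forall i, vec (b i) = trans i f;
  real_one : vec o = 1;
  real_dg : forall j, (dg (v j) < dg f)%N
}.

Hypothesis rV : realization.

Lemma wcoef_vec l z : wcoef (wl l) (vec z) = z 0 l.
Proof.
rewrite /vec linear_sum (bigD1 l) //= linearZ /= (real_dual rV) eqxx mulr1.
rewrite big1 ?addr0 // => j jl.
by rewrite linearZ /= (real_dual rV) (negbTE jl) mulr0.
Qed.

Lemma vec_inj : injective vec.
Proof. by move=> y z e; apply/rowP => l; rewrite -!wcoef_vec e. Qed.

Lemma vec_delta j : vec (delta_mx 0 j) = v j.
Proof.
rewrite /vec (bigD1 j) //= mxE !eqxx scale1r big1 ?addr0 // => l /negbTE jl.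
by rewrite mxE jl scale0r.
Qed.

Lemma dg_vec z : (dg (vec z) < dg f)%N.
Proof.
have [e|] := posnP (dg f); last first.
  case: (dg f) (real_dg rV) => // n H _.
  by rewrite ltnS; apply: dg_sum => j _; apply: dgZ; rewrite -ltnS.
have := real_one rV; rewrite /vec big1 => [/eqP|j _]; first by rewrite eq_sym oner_eq0.
by have := real_dg rV j; rewrite e.
Qed.

Lemma dg_gt1 : (1 < dg f)%N.
Proof.
apply: leq_ltn_trans (dg_vec o); rewrite (real_one rV).
by apply: dg_gt0; rewrite oner_eq0.
Qed.

Lemma dg_fiber : (dg f <= dg fiber)%N.
Proof.
rewrite leqNgt; apply/negP; have := dg_gt1.
case E: (dg f) => [|n] //; rewrite !ltnS => n0 le; suff : (dg f <= n)%N by rewrite E ltnn.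
rewrite -[f](subrK t%:A); apply: dgD => //; exact: leq_trans (dgC _ _) _.
Qed.

(** The second summand is the rank-one effect of [eps]. The dependence on t is affine, so one matrix
    over k[t] serves all specializations. *)
Definition shift_mx i : 'M[F]_q := t *: N i + (\col_j eps (v j)) *m b i.

Lemma eps_vec z : (eps (vec z))%:M = z *m \col_j eps (v j).
Proof.
apply/matrixP => ? ?; rewrite !ord1 !mxE mulr1n /vec linear_sum.
by apply: eq_bigr => j _; rewrite linearZ /= mxE.
Qed.

Lemma trans_vec i z : trans i (vec z) = vec (z *m N i).
Proof.
rewrite mulmx_sum_row [RHS]linear_sum {1}/vec linear_sum; apply: eq_bigr => j _.
by rewrite !linearZ /= (real_trans rV).
Qed.

Lemma shift_vec i z : shift i (vec z) = vec (z *m shift_mx i).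
Proof.
rewrite /shift trans_vec -(real_base rV) /shift_mx mulmxDr linearD /=.
by rewrite -scalemxAr linearZ /= mulmxA -eps_vec mul_scalar_mx linearZ.
Qed.

Lemma shiftw_vec w z : shiftw w (vec z) = vec (z *m word_mx shift_mx w).
Proof.
elim/last_ind: w => [|w i IHw]; first by rewrite mulmx1.
by rewrite /shiftw foldl_rcons -/(shiftw _ _) IHw shift_vec word_mx_rcons mulmxA.
Qed.

Lemma word_mx_cons i w : word_mx shift_mx (i :: w) = shift_mx i *m word_mx shift_mx w.
Proof.
elim/last_ind: w => [|w j IHw]; first by rewrite /word_mx /= mul1mx mulmx1.
by rewrite -rcons_cons !word_mx_rcons IHw mulmxA.
Qed.

Lemma one_shift_mx i : o *m shift_mx i = b i.
Proof. by apply: vec_inj; rewrite -shift_vec (real_one rV) shift1 (real_base rV). Qed.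

(** The transductions exhaust g, and what the shifts add on the way are multiples of the
    [trans i f], which lie in V. *)
Lemma shiftw_span w g : (dg g <= size w)%N -> exists z, shiftw w g = vec z.
Proof.
elim: w g => [|i w IHw] g le /=.
  by exists 0; move: le; rewrite leqn0 dg_eq0 linear0 => /eqP.
have [z ez] := IHw _ (dg_trans i le).
rewrite [shift i g]/shift linearD !linearZ /= ez -(real_base rV) shiftw_vec.
by rewrite -!linearZ -linearD; eexists.
Qed.

(* A factorization fiber = a c yields the proper subspace V \cap A c. *)
Lemma factor_not_full (a c : A) : fiber = a * c -> (1 < dg a)%N -> (1 < dg c)%N ->
  exists X, ~ word_span shift_mx X.
Proof.
move=> pE a1 c1; pose P z := exists u, vec z = u * c.
have shiftP i u : shift i (u * c) = (t *: trans i u + eps (u * c) *: trans i a) * c.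
  have ac : eps a * eps c = - t by rewrite -eps_fiber pE rmorphM.
  rewrite shift_mul [shift i c]/shift -trans_fiber pE transM !scalerDr.
  rewrite mulrDl -!scalerAl !scalerA rmorphM /=.
  have -> : eps u * eps c * eps a = - (eps u * t) by rewrite -mulrA [eps c * _]mulrC ac mulrN.
  by rewrite scaleNr [X in _ + X]addrCA subrr addr0.
(* This provides a nonzero vector of V inside A c: long shifts of c land in V, and if all of them
   were multiples of a c, so would be c, making a invertible. *)
have [w [sw nw]] : exists w, size w = dg c /\ ~ fiber_multiple (shiftw w c).
  apply: contrapT => H; have : fiber_multiple c.
    apply: (@fiber_multiple_shiftw (dg c)) => w sw; apply: contrapT => nw.
    by apply: H; exists w.
  move=> [u]; rewrite pE mulrA -{1}[c]mul1r => /fmulIf.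
  have c0 : c != 0 by rewrite -dg_eq0 -lt0n (leq_trans _ c1).
  by move=> /(_ c0)/esym/dg_unit[_ e]; rewrite e in a1.
have [z zE] := shiftw_span (eq_leq (esym sw)).
have [u uE] : exists u, shiftw w c = u * c.
  suff H u : exists u', shiftw w (u * c) = u' * c by have := H 1; rewrite mul1r.
  elim: (w) u => [|i w' IHw] u; first by exists u.
  by rewrite /shiftw /= shiftP; apply: IHw.
have z0 : z != 0.
  apply/eqP => z0; apply: nw; exists 0; by rewrite zE z0 linear0 mul0r.
have [l zl] : exists l, z 0 l != 0.
  exact/rV0Pn.
(* This rank-one matrix sends z to o. Were it a combination of word matrices, 1 would lie in A c,
   which is stable under shifts. *)
exists ((z 0 l)^-1 *: (delta_mx l 0 *m o)) => -[s sE].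
have [y yE] : P o.
  have -> : o = z *m ((z 0 l)^-1 *: (delta_mx l 0 *m o)).
    rewrite -scalemxAr mulmxA -colE [col _ _]mx11_scalar mxE mul_scalar_mx.
    by rewrite scalerA mulVf ?scale1r.
  rewrite sE mulmx_sumr; elim/big_ind: _.
  - by exists 0; rewrite mul0r linear0.
  - by move=> x y [r er] [r' er']; exists (r + r'); rewrite mulrDl -er -er' linearD.
  - move=> x _; rewrite -scalemxAr; have [r er] : P (z *m word_mx shift_mx x.2).
      elim/last_ind: (x.2) => [|w' i [r er]]; first by exists u; rewrite mulmx1 -zE.
      by rewrite word_mx_rcons mulmxA; eexists; rewrite -shift_vec er shiftP.
    by exists (x.1 *: r); rewrite linearZ /= er -scalerAl.
move: yE; rewrite (real_one rV) => /esym/dg_unit[_ e].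
by rewrite e in c1.
Qed.

(** Since t (trans i g) = shift i g - (eps g) (trans i f), a shift-stable space containing the
    [trans i f] is stable under the transductions, which produce all of V from these. *)
Lemma stable_base_full (B : 'M[F]_q) :
  (forall i, B *m shift_mx i <= B)%MS -> (forall i, b i <= B)%MS -> row_full B.
Proof.
move=> sB bB; pose P g := exists2 z, (z <= B)%MS & g = vec z.
have PD g h : P g -> P h -> P (g + h).
  by move=> [y yB ->] [z zB ->]; exists (y + z); rewrite ?addmx_sub ?linearD.
have PZ c g : P g -> P (c *: g).
  by move=> [y yB ->]; exists (c *: y); rewrite ?scalemx_sub ?linearZ.
have Pb i : P (trans i f) by exists (b i); rewrite ?(real_base rV).
have Pw w : w != [::] -> P (transw w f).
  elim/last_ind: w => // w i IHw _.
  have [/eqP->|/IHw[z zB ez]] := boolP (w == [::]); first exact: Pb.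
  rewrite /transw foldl_rcons -/(transw _ _).
  have -> : trans i (transw w f) =
      t^-1 *: (shift i (transw w f) + (- eps (transw w f)) *: trans i f).
    by rewrite /shift scaleNr addrK scalerA mulVf ?scale1r.
  apply/PZ/PD/PZ => //; rewrite ez shift_vec; exists (z *m shift_mx i) => //.
  exact: submx_trans (submxMr _ zB) (sB i).
rewrite -sub1mx; apply/row_subP => j; rewrite row1.
have [s [/allP sP sE]] := real_span rV j.
have : P (v j).
  rewrite sE big_seq; elim/big_ind: _ => //.
    by exists 0; rewrite ?sub0mx ?linear0.
  by move=> x /sP/Pw/PZ; apply.
by case=> z zB; rewrite -vec_delta => /vec_inj ->.
Qed.

(** Z acts as an endomorphism of A / A (f - t), that is, as right multiplication by the image e of
    1; as f - t is zero there, so is (f - t) e. If e is a scalar c, the kernel of Z - c is stable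
    and contains o, hence every [b i], and is therefore everything. *)
Lemma commuting_endo (Z : 'M[F]_q) :
    (forall i, Z *m shift_mx i = shift_mx i *m Z) ->
  (exists e', fiber * vec (o *m Z) = e' * fiber) /\
  (forall c, vec (o *m Z) = c%:A -> Z = c%:M).
Proof.
move=> ZC; split; last first.
  move=> c; rewrite -(real_one rV) -linearZ => /vec_inj oZ.
  apply/eqP; rewrite -subr_eq0; set D := Z - _.
  have CD i : shift_mx i *m D = D *m shift_mx i.
    by rewrite /D mulmxBr mulmxBl -ZC mul_mx_scalar mul_scalar_mx.
  have oK : (o <= kermx D)%MS.
    by apply/sub_kermxP; rewrite /D mulmxBr oZ mul_mx_scalar subrr.
  have /row_fullP[Y YK] : row_full (kermx D).
    apply: stable_base_full => i; apply/sub_kermxP.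
      by rewrite -mulmxA CD mulmxA mulmx_ker mul0mx.
    by rewrite -one_shift_mx -mulmxA CD mulmxA (sub_kermxP oK) mul0mx.
  by rewrite -(mul1mx D) -YK -mulmxA mulmx_ker mulmx0.
set e := vec _.
pose Q g h := exists z, g = vec z /\ h = vec (z *m Z).
have QD c g h g' h' : Q g h -> Q g' h' -> Q (c *: g + g') (c *: h + h').
  move=> [z [-> ->]] [z' [-> ->]]; exists (c *: z + z').
  by rewrite mulmxDl -scalemxAl !linearP.
have QZ c g h : Q g h -> Q (c *: g) (c *: h).
  by move=> [z [-> ->]]; exists (c *: z); rewrite -scalemxAl !linearZ.
have QS i g h : Q g h -> Q (shift i g) (shift i h).
  move=> [z [-> ->]]; exists (z *m shift_mx i).
  by rewrite !shift_vec -!mulmxA ZC.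
have Q1 : Q 1 e by exists o; rewrite (real_one rV).
have QSw w g h : Q g h -> Q (shiftw w g) (shiftw w h).
  by elim: w g h => //= i w IHw g h /(QS i)/IHw.
have Qmul w g : (dg g <= size w)%N -> Q (shiftw w g) (shiftw w (g * e)).
  elim: w g => [|i w IHw] g le.
    move: le; rewrite leqn0 dg_eq0 => /eqP->; rewrite mul0r.
    by exists 0; rewrite mul0mx !linear0.
  rewrite !shiftw_cons -[g in X in Q X]mulr1 !shift_mul mulr1.
  have E c c' x y : shiftw w (c *: x + c' *: y) = c *: shiftw w x + c' *: shiftw w y.
    by rewrite linearD !linearZ.
  rewrite (E _ _ (trans i g)) (E _ _ (trans i g * e)); apply: (QD t); first by apply/IHw/dg_trans.
  exact/QZ/QSw/QS.
(* Z maps the shifts of the fiber to those of [fiber * e]; long shifts of the former vanish, hence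
   also the latter. *)
apply: (@fiber_multiple_shiftw (dg fiber).+1) => w sw; exists 0; rewrite mul0r.
have [|z [z1 ->]] := Qmul w fiber; first by rewrite sw.
move: z1; rewrite -[fiber]mul1r shiftw_fiber_multiple.
  by rewrite -(linear0 vec) => /vec_inj <-; rewrite mul0mx.
rewrite sw -[1]scale1r; exact: leq_trans (dgC A 1) _.
Qed.

Section Stable.
Variable B : 'M[F]_q.
Hypothesis sB : forall i, (B *m shift_mx i <= B)%MS.

Let inB g := exists2 z, (z <= B)%MS & g = vec z.

Lemma stableD g h : inB g -> inB h -> inB (g + h).
Proof. by move=> [y yB ->] [z zB ->]; exists (y + z); rewrite ?addmx_sub ?linearD. Qed.

Lemma stableZ c g : inB g -> inB (c *: g).
Proof. by move=> [y yB ->]; exists (c *: y); rewrite ?scalemx_sub ?linearZ. Qed.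

Lemma stable_shift i g : inB g -> inB (shift i g).
Proof.
move=> [z zB ->]; rewrite shift_vec; exists (z *m shift_mx i) => //.
exact: submx_trans (submxMr _ zB) (sB i).
Qed.

Lemma stable_shiftw w g : inB g -> inB (shiftw w g).
Proof. by elim: w g => [//|i w IHw] g /(stable_shift i)/IHw. Qed.

Lemma stable_shiftwM w g h : inB h -> (dg g <= size w)%N -> inB (shiftw w (g * h)).
Proof.
move=> Bh; elim: w g => [|i w IHw] g le.
  move: le; rewrite leqn0 dg_eq0 => /eqP->; rewrite mul0r.
  by exists 0; rewrite ?sub0mx ?linear0.
rewrite shiftw_cons shift_mul linearD; apply: stableD.
  by rewrite linearZ; apply/stableZ/IHw/dg_trans.
by rewrite linearZ; apply/stableZ/stable_shiftw/stable_shift.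
Qed.

(** The length n is lowered one by one: the vectors whose shifts by words of length n all lie in B
    form a stable space C. If length n.+1 works for 1, then C contains every [b i], so it is full
    and contains o. *)
Lemma stable_contains_one_full n :
  (forall w, size w = n -> inB (shiftw w 1)) -> row_full B.
Proof.
have inE z : inB (vec z) -> (z <= B)%MS by case=> y yB /vec_inj ->.
move=> H; have {}H w : size w = n -> (o *m word_mx shift_mx w <= B)%MS.
  by move=> /H; rewrite -(real_one rV) shiftw_vec => /inE.
elim: n H => [|n IHn] H.
  have oB : (o <= B)%MS by have := H [::] erefl; rewrite mulmx1.
  apply: stable_base_full => // i; rewrite -one_shift_mx.
  exact: submx_trans (submxMr _ oB) (sB i).
apply: IHn => w0 sw0.
pose P (z : 'rV_q) := forall w, size w = n -> (z *m word_mx shift_mx w <= B)%MS.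
have [|||C CE] := @subspace_matrix _ _ P.
- by move=> w _; rewrite mul0mx sub0mx.
- by move=> y z Py Pz w sw; rewrite mulmxDl addmx_sub ?Py ?Pz.
- by move=> c z Pz w sw; rewrite -scalemxAl scalemx_sub ?Pz.
suff fC : row_full C by have /CE := submx_full o fC; apply.
apply: stable_base_full => i.
  apply/row_subP => l; apply/CE; rewrite row_mul => w sw.
  rewrite -mulmxA -word_mx_cons lastI word_mx_rcons mulmxA.
  apply: submx_trans (sB (last i w)); apply: submxMr.
  by have /CE := row_sub l C; apply; rewrite size_belast.
apply/CE => w sw; rewrite -one_shift_mx -mulmxA -word_mx_cons.
by apply: H; rewrite /= sw.
Qed.

(* The left ideal generated by the subspace and the fiber has rank one: the
   relations t u = \sum_i x_i (shift i u) - eps u fiber show that modulo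
   constant terms its generators are determined by the coordinates of fiber. *)
Lemma stable_factor : B != 0 -> ~~ row_full B ->
  exists a c : A, [/\ fiber = a * c, (1 < dg a)%N & (1 < dg c)%N].
Proof.
move=> B0 nfB.
pose y (x : option 'I_q) : A := if x is Some j then vec (row j B) else fiber.
have [c [cE ind]] := lspan_basis y.
have uniq r s l : \sum_l r l * c l = \sum_l s l * c l -> c l != 0 -> r l = s l.
  move=> rs cl; have : \sum_l (r l - s l) * c l = 0.
    by under eq_bigr do rewrite mulrBl; rewrite sumrB rs subrr.
  move/ind/(_ l)/eqP; rewrite fmulf_eq0 (negbTE cl) orbF subr_eq0.
  by move/eqP.
have /choice[G GE] : forall x, lspan c (y x) by move=> x; apply/cE/lspan_gen.
have /choice[H HE] : forall x, lspan y (c x) by move=> x; apply/cE/lspan_gen.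
have /choice[sm smE] : forall i, exists X : 'M_q, B *m shift_mx i = X *m B.
  by move=> i; have /submxP[X ->] := sB i; exists X.
(* Comparing constant terms in t y = \sum_i x_i (shift i y) - (eps y) fiber leaves the factor - eps
   y / t. *)
pose gam (x : option 'I_q) : F := if x is Some j then - (t^-1 * eps (y x)) else 1.
have key1 x l : c l != 0 -> eps (G x l) = gam x * eps (G None l).
  case: x => [j|] cl; last by rewrite mul1r.
  have E : t *: G (Some j) l =
      (\sum_i letter i * \sum_m sm i j m *: G (Some m) l) - eps (y (Some j)) *: G None l.
    apply: (uniq (fun l => t *: G (Some j) l) (fun l =>
      (\sum_i letter i * \sum_m sm i j m *: G (Some m) l) - eps (y (Some j)) *: G None l)) => //.
    under eq_bigr do rewrite -scalerAl.
    rewrite -scaler_sumr -GE [LHS]shift_decomp.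
    under [RHS]eq_bigr do rewrite mulrBl -scalerAl.
    rewrite sumrB -scaler_sumr -(GE None); congr (_ - _).
    under [RHS]eq_bigr do rewrite mulr_suml.
    rewrite exchange_big /=; apply: eq_bigr => i _.
    under eq_bigr do rewrite -mulrA mulr_suml.
    rewrite -mulr_sumr exchange_big /=; congr (_ * _).
    rewrite shift_vec -row_mul smE row_mul mulmx_sum_row linear_sum.
    apply: eq_bigr => m _; rewrite linearZ /= -/(y (Some m)) GE scaler_sumr mxE.
    by apply: eq_bigr => l' _; rewrite scalerAl.
  have := congr1 eps E; rewrite raddfB /= !epsZ raddf_sum big1 ?sub0r => [e|i _]; last exact: epsXM.
  by rewrite mulNr -mulrA -mulrN -e mulKf.
(* These are the constant terms of the identity matrix H G, restricted to the nonzero generators.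
   The right side has rank at most one, so no two generators are nonzero. *)
have key2 l m : c l != 0 -> c m != 0 ->
    (l == m)%:R = (\sum_x eps (H l x) * gam x) * eps (G None m).
  move=> cl cm; have E : (l == m)%:R = \sum_x H l x * G x m.
    apply: (uniq (fun m => (l == m)%:R) (fun m => \sum_x H l x * G x m)) => //.
    rewrite (bigD1 l) //= eqxx mul1r big1 ?addr0; last first.
      by move=> m' /negbTE; rewrite eq_sym => ->; rewrite mul0r.
    rewrite [LHS]HE; under [RHS]eq_bigr do rewrite mulr_suml.
    rewrite exchange_big /=; apply: eq_bigr => x _.
    by rewrite GE mulr_sumr; apply: eq_bigr => m' _; rewrite mulrA.
  have := congr1 eps E; rewrite rmorph_nat raddf_sum => ->.
  rewrite mulr_suml; apply: eq_bigr => x _.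
  by rewrite /= [LHS]rmorphM /= (key1 x m cm) mulrA.
have fib0 : fiber != 0.
  by rewrite -dg_eq0 -lt0n (leq_trans _ dg_fiber) // ltnW // dg_gt1.
have [l cl] : exists l, c l != 0.
  apply: contrapT => nc; case/eqP: fib0; rewrite -/(y None) GE big1 // => l _.
  by have [->|cl] := eqVneq (c l) 0; [rewrite mulr0|case: nc; exists l].
have c0 m : m != l -> c m = 0.
  move=> ml; apply/eqP/contraT => cm.
  have := key2 l m cl cm; rewrite eq_sym (negbTE ml) => /esym/eqP.
  rewrite mulf_eq0 => /orP[]/eqP e.
    by have /eqP := key2 l l cl cl; rewrite eqxx e mul0r oner_eq0.
  by have /eqP := key2 m m cm cm; rewrite eqxx e mulr0 oner_eq0.
have yE x : y x = G x l * c l.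
  by rewrite [LHS]GE (bigD1 l) //= big1 ?addr0 // => m /c0 ->; rewrite mulr0.
exists (G None l), (c l); split; first exact: (yE None).
(* A constant a would make every row of B a left multiple of the fiber, whose degree exceeds that of
   all vectors of V; then B = 0. *)
- rewrite ltnNge; apply/negP => /dg_le1; set k := eps _ => kE.
  have k0 : k != 0.
    by apply: contraNneq fib0 => k0; rewrite -/(y None) yE kE k0 scale0r mul0r.
  case/eqP: B0; apply/row_matrixP => j; rewrite row0; apply: vec_inj; rewrite linear0.
  rewrite -/(y (Some j)) yE; have [->|Gj] := eqVneq (G (Some j) l) 0; first by rewrite mul0r.
  have e : k *: y (Some j) = G (Some j) l * fiber.
    by rewrite -/(y None) (yE None) kE (yE (Some j)) mulr_algl -scalerAr.
  have := dg_vec (k *: row j B); rewrite linearZ /= -/(y (Some j)) e dgM_eq //.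
  by rewrite ltnNge (leq_trans dg_fiber) ?leq_addl.
(* For a constant c the left ideal contains 1. Long shifts kill the fiber term of an expression of 1
   and leave its other terms in B. *)
- rewrite ltnNge; apply/negP => /dg_le1; set k := eps _ => kE.
  have k0 : k != 0 by apply: contraNneq cl => k0; rewrite kE k0 scale0r.
  have [r rE] : lspan y 1.
    apply/cE; have -> : 1 = k^-1%:A * c l.
      by rewrite kE mulr_algl scalerA mulVf // scale1r.
    exact/lspanM/lspan_gen.
  case/negP: nfB; apply: (@stable_contains_one_full (\max_x dg (r x))) => w sw.
  rewrite rE linear_sum; elim/big_ind: _ => //.
  + by exists 0; rewrite ?sub0mx ?linear0.
  + exact: stableD.
  + move=> x _; have le : (dg (r x) <= size w)%N by rewrite sw; apply: leq_bigmax.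
    case: x le => [j|] le; first by apply: stable_shiftwM => //; exists (row j B); rewrite ?row_sub.
    by exists 0; rewrite ?sub0mx // linear0; apply: shiftw_fiber_multiple.
Qed.

End Stable.

End Realized.
End Shift.

(** * Change of scalars and Gauss' lemma *)

Section Construction.
Variables (R : comNzRingType) (d : nat) (A : freeAlgType R d).
Implicit Types (c : seq 'I_d -> R).

Fixpoint of_coeffs n c : A :=
  if n is n'.+1 then (c [::])%:A + \sum_i letter i * of_coeffs n' (fun w => c (i :: w))
  else 0.

Lemma wcoef_of_coeffs n c w : wcoef w (of_coeffs n c) = if (size w < n)%N then c w else 0.
Proof.
elim: n c w => [|n IHn] c w; first by rewrite linear0.
case: w => [|i w] /=.
  rewrite wcoef_nil raddfD /= epsC raddf_sum big1 ?addr0 // => i _.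
  exact: epsXM.
rewrite wcoef_cons linearD /= transC add0r linear_sum (bigD1 i) //= transXM eqxx mulr1n.
rewrite big1 ?addr0 ?IHn // => j /negbTE ji.
by rewrite transXM ji.
Qed.

End Construction.

Section BaseChange.
Variables (R R' : comNzRingType) (iota : {rmorphism R -> R'}) (d : nat).
Variables (A : freeAlgType R d) (A' : freeAlgType R' d).

Definition base_change (g : A) : A' := of_coeffs A' (dg g) (fun w => iota (wcoef w g)).

Lemma wcoef_base_change w g : wcoef w (base_change g) = iota (wcoef w g).
Proof.
rewrite wcoef_of_coeffs; case: ltnP => // le.
by rewrite wcoef_dg // rmorph0.
Qed.

Fact base_change_is_zmod_morphism : zmod_morphism base_change.
Proof.
by move=> g h; apply: eq_wcoef => w; rewrite linearB /= !wcoef_base_change linearB rmorphB.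
Qed.
HB.instance Definition _ := GRing.isZmodMorphism.Build A A' base_change
  base_change_is_zmod_morphism.

Lemma base_changeC c : base_change c%:A = (iota c)%:A.
Proof.
apply: eq_wcoef => w; rewrite wcoef_base_change.
case: w => [|i w]; first by rewrite !wcoef_nil !epsC.
by rewrite !wcoef_cons !transC !linear0 rmorph0.
Qed.

Fact base_change_is_monoid_morphism : monoid_morphism base_change.
Proof.
split=> [|g h]; first by rewrite -(scale1r 1) base_changeC rmorph1 scale1r.
apply: eq_wcoef => w; rewrite mulr_wcoef wcoef_base_change mulr_wcoef rmorph_sum.
by apply: eq_bigr => k _; rewrite rmorphM !wcoef_base_change.
Qed.
HB.instance Definition _ := GRing.isMonoidMorphism.Build A A' base_change
  base_change_is_monoid_morphism.

Lemma base_changeZ c g : base_change (c *: g) = iota c *: base_change g.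
Proof. by rewrite -mulr_algl rmorphM /= base_changeC mulr_algl. Qed.

Lemma transw_base_change w g : transw w (base_change g) = base_change (transw w g).
Proof.
apply: eq_wcoef => w'; rewrite wcoef_base_change /wcoef -!transw_cat.
by rewrite -/(wcoef _ _) wcoef_base_change.
Qed.

Lemma trans_base_change i g : trans i (base_change g) = base_change (trans i g).
Proof. exact: (transw_base_change [:: i]). Qed.

Lemma eps_base_change g : eps (base_change g) = iota (eps g).
Proof. exact: (wcoef_base_change [::]). Qed.

Hypothesis iota_inj : injective iota.

Lemma base_change_inj : injective base_change.
Proof.
move=> g h e; apply: eq_wcoef => w; apply: iota_inj.
by rewrite -!wcoef_base_change e.
Qed.

Lemma dg_base_change g : dg (base_change g) = dg g.
Proof.
apply/eqP; rewrite eqn_leq; apply/andP; split; apply/dg_leP => w le.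
  by rewrite transw_base_change transw_dg ?rmorph0.
by apply: base_change_inj; rewrite rmorph0 -transw_base_change transw_dg.
Qed.

End BaseChange.

Section PolyCoef.
Variables (k : fieldType) (d : nat) (A : freeAlgType k d).
Implicit Types (P Q Y : {poly A}) (p s : {poly k}) (w : seq 'I_d).

(** Reads [{poly A}] as the free algebra over k[t], where [scal] embeds the central k[t]. *)
Definition pwcoef w P : {poly k} := map_poly (wcoef w) P.
HB.instance Definition _ w := GRing.Additive.copy (pwcoef w) (map_poly (wcoef w)).

Lemma coef_pwcoef w P i : (pwcoef w P)`_i = wcoef w P`_i.
Proof. exact: coef_map. Qed.

Lemma eq_pwcoef P Q : (forall w, pwcoef w P = pwcoef w Q) -> P = Q.
Proof.
move=> H; apply/polyP => i; apply: eq_wcoef => w.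
by rewrite -!coef_pwcoef H.
Qed.

Lemma pwcoefM w P Q :
  pwcoef w (P * Q) = \sum_(0 <= l < (size w).+1) pwcoef (take l w) P * pwcoef (drop l w) Q.
Proof.
apply/polyP => i; rewrite coef_pwcoef coefM linear_sum /= coef_sum.
under eq_bigr do rewrite mulr_wcoef.
rewrite exchange_big; apply: eq_bigr => l _; rewrite coefM.
by apply: eq_bigr => j _; rewrite !coef_pwcoef.
Qed.

Lemma pwcoefC w (g : A) : pwcoef w g%:P = (wcoef w g)%:P.
Proof. by rewrite /pwcoef map_polyC. Qed.

Lemma pwcoef_bound P w : exists N, forall w, (N <= size w)%N -> pwcoef w P = 0.
Proof.
exists (\max_(i < size P) dg P`_i) => w' le; apply/polyP => i.
rewrite coef_pwcoef coef0; case: (ltnP i (size P)) => [lt|/(nth_default _)->].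
  by rewrite wcoef_dg // (leq_trans _ le) // (leq_bigmax (Ordinal lt)).
exact: linear0.
Qed.

Definition scal p : {poly A} := map_poly (in_alg A) p.
HB.instance Definition _ := GRing.RMorphism.copy scal (map_poly (in_alg A)).

Lemma scal_comm p P : GRing.comm (scal p) P.
Proof.
apply/polyP => i; rewrite coefM coefMr; apply: eq_bigr => j _.
by rewrite coef_map /= mulr_algl -[RHS]scalerAr mulr1.
Qed.

Lemma pwcoef_scalM w p P : pwcoef w (scal p * P) = p * pwcoef w P.
Proof.
apply/polyP => i; rewrite coef_pwcoef coefM linear_sum coefM.
by apply: eq_bigr => j _; rewrite coef_map /= mulr_algl linearZ /= coef_pwcoef.
Qed.

Lemma pwcoef_scal w p : pwcoef w (scal p) = if w == [::] then p else 0.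
Proof.
rewrite -[scal p]mulr1 pwcoef_scalM -[1]/(1%:P) pwcoefC; case: w => [|j w] /=.
  by rewrite /wcoef /= rmorph1 mulr1.
by rewrite wcoef_cons trans1 linear0 mulr0.
Qed.

Lemma scal_inj : injective scal.
Proof. by move=> p q e; have := congr1 (pwcoef [::]) e; rewrite !pwcoef_scal. Qed.

Lemma scalC (c : k) : scal c%:P = (c%:A)%:P.
Proof. by rewrite /scal map_polyC. Qed.

Lemma scalX : scal 'X = 'X.
Proof. by rewrite /scal map_polyX. Qed.

Lemma pmulf_neq0 P Q : P != 0 -> Q != 0 -> lead_coef P * lead_coef Q != 0.
Proof. by move=> P0 Q0; rewrite fmulf_neq0 ?lead_coef_eq0. Qed.

Lemma psize_mul P Q : P != 0 -> Q != 0 -> size (P * Q) = (size P + size Q).-1.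
Proof. by move=> P0 Q0; apply/size_proper_mul/pmulf_neq0. Qed.

Lemma pmul_eq0 P Q : (P * Q == 0) = (P == 0) || (Q == 0).
Proof.
have [->|P0] := eqVneq P 0; first by rewrite mul0r eqxx.
have [->|Q0] := eqVneq Q 0; first by rewrite mulr0 eqxx.
apply: contraNF (pmulf_neq0 P0 Q0) => /eqP e.
by rewrite -lead_coef_proper_mul ?pmulf_neq0 // e lead_coef0.
Qed.

Lemma pmulfI P : P != 0 -> injective (fun Q => P * Q).
Proof.
move=> P0 Q Q' /eqP; rewrite -subr_eq0 -mulrBr pmul_eq0 (negbTE P0) /=.
by rewrite subr_eq0 => /eqP.
Qed.

Lemma scal_eq0 p : (scal p == 0) = (p == 0).
Proof. by rewrite -(inj_eq scal_inj) rmorph0. Qed.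

Lemma of_pwcoefs N (c : seq 'I_d -> {poly k}) :
  exists P, forall w, pwcoef w P = if (size w < N)%N then c w else 0.
Proof.
elim: N c => [|N IHN] c; first by exists 0 => w; rewrite raddf0.
have /choice[Pi PiE] := fun i => IHN (fun w => c (i :: w)).
exists (scal (c [::]) + \sum_i (letter i)%:P * Pi i) => w.
rewrite raddfD /= pwcoef_scal raddf_sum /=.
have E i v Q : pwcoef v ((letter i)%:P * Q) = if v is j :: v' then pwcoef v' Q *+ (i == j) else 0.
  apply/polyP => n; rewrite coef_pwcoef coefCM; case: v => [|j v].
    by rewrite coef0; apply: epsXM.
  by rewrite wcoef_cons transXM coefMn coef_pwcoef linearMn.
case: w => [|j w] /=; first by rewrite big1 ?addr0 // => i _; rewrite E.
rewrite add0r (bigD1 j) //= E eqxx mulr1n PiE big1 ?addr0 // => i /negbTE ij.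
by rewrite E ij.
Qed.

Definition pdvd p P := forall w, p %| pwcoef w P.

Lemma pdvdP p P : p != 0 -> pdvd p P -> exists Q, P = scal p * Q.
Proof.
move=> p0 H; have [N HN] := pwcoef_bound P [::].
have [Q QE] := of_pwcoefs N (fun w => pwcoef w P %/ p).
exists Q; apply: eq_pwcoef => w; rewrite pwcoef_scalM QE.
case: ltnP => [_|/HN->]; last by rewrite mulr0.
by rewrite mulrC divpK.
Qed.

(* Gauss: if the irreducible p divides neither factor, take in each a word of
   maximal length with coefficient prime to p. *)
Lemma pdvd_mul p P Q : irreducible_poly p -> pdvd p (P * Q) -> pdvd p P \/ pdvd p Q.
Proof.
move=> irrp PQ; apply: contrapT => H.
have maxw P' : ~ pdvd p P' -> exists w, ~~ (p %| pwcoef w P') /\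
    forall v, (size w < size v)%N -> p %| pwcoef v P'.
  move=> nP; pose S n := `[< exists w, size w = n /\ ~~ (p %| pwcoef w P') >].
  have exS : exists n, S n.
    apply: contrapT => nS; apply: nP => w; apply/contraT => pw; case: nS.
    by exists (size w); apply/asboolP; exists w.
  have [N HN] := pwcoef_bound P' [::].
  have ubS n : S n -> (n <= N)%N.
    move/asboolP => [w [<- pw]]; rewrite leqNgt; apply: contra pw => lt.
    by rewrite HN ?dvdp0 // ltnW.
  case: (ex_maxnP exS ubS) => n /asboolP[w [sw pw]] maxn.
  exists w; split=> // v lt; apply/contraT => pv.
  have /maxn : S (size v) by apply/asboolP; exists v.
  by rewrite leqNgt -sw lt.
have [w [pw maxP]] : exists w, ~~ (p %| pwcoef w P) /\
    forall v, (size w < size v)%N -> p %| pwcoef v P.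
  by apply: maxw => h; apply: H; left.
have [w' [pw' maxQ]] : exists w, ~~ (p %| pwcoef w Q) /\
    forall v, (size w < size v)%N -> p %| pwcoef v Q.
  by apply: maxw => h; apply: H; right.
have := PQ (w ++ w'); rewrite pwcoefM big_mkord.
have lw : (size w < (size (w ++ w')).+1)%N by rewrite size_cat ltnS leq_addr.
rewrite (bigD1 (Ordinal lw)) //= take_size_cat // drop_size_cat // dvdp_addl; last first.
  elim/big_ind: _ => [|x y|l]; [exact: dvdp0|exact: dvdp_add|].
  rewrite -val_eqE /= neq_ltn => /orP[lt|lt].
    apply/dvdp_mull/maxQ; rewrite size_drop [X in (X - _)%N]size_cat.
    by rewrite -addnBAC ?(ltnW lt) // -{1}[size w']add0n ltn_add2r subn_gt0.
  apply/dvdp_mulr/maxP; rewrite size_take_min leq_min lt.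
  by rewrite (leq_trans lt) // -ltnS ltn_ord.
by rewrite Gauss_dvdpr ?(negbTE pw') // irreducible_poly_coprime.
Qed.

Lemma irreducible_divisor p : (1 < size p)%N -> exists2 q, irreducible_poly q & q %| p.
Proof.
elim: {p}(size p) {-2}p (leqnn (size p)) => [|n IHn] p le p1.
  by move: p1; rewrite ltnNge (leq_trans le).
have [irr|] := pselect (irreducible_poly p); first by exists p.
move=> nirr; have [q [q1 qp nqp]] : exists q : {poly k}, [/\ size q != 1, q %| p & ~~ (q %= p)].
  apply: contrapT => H; apply: nirr; split=> // q q1 qp.
  by apply/contraT => nqp; case: H; exists q.
have p0 : p != 0 by rewrite -size_poly_gt0 (ltn_trans _ p1).
have q0 : q != 0 by apply: contraTneq qp => ->; rewrite dvd0p.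
have lt : (size q < size p)%N.
  by rewrite ltn_neqAle dvdp_leq // andbT; rewrite (dvdp_size_eqp qp).
have [||r irr rq] := IHn q.
- by rewrite -ltnS (leq_trans lt).
- by rewrite ltn_neqAle eq_sym q1 size_poly_gt0.
by exists r => //; apply: dvdp_trans qp.
Qed.

(** The irreducible factors of s are cancelled one at a time, each against P or Q according to
    [pdvd_mul]. *)
Lemma gauss_split s Y P Q : s != 0 -> scal s * Y = P * Q ->
  exists r1 r2 P' Q', [/\ P = scal r1 * P', Q = scal r2 * Q', s = r1 * r2 & Y = P' * Q'].
Proof.
elim: {s}(size s) {-2}s (leqnn (size s)) Y P Q => [|n IHn] s le Y P Q s0 e.
  by move: s0; rewrite -size_poly_leq0 le.
have [s1|s1] := leqP (size s) 1.
  have [c sc] : exists c, s = c%:P by exists s`_0; apply: size1_polyC.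
  have c0 : c != 0 by apply: contraNneq s0; rewrite sc => ->.
  exists 1, s, P, (scal (c^-1)%:P * Q); rewrite rmorph1 !mul1r mulrA -rmorphM /=.
  rewrite {1}sc -polyCM divff // rmorph1 mul1r; split=> //.
  by rewrite mulrA -scal_comm -mulrA -e mulrA -rmorphM /= sc -polyCM mulVf // rmorph1 mul1r.
have [p irrp /dvdpP[s' es]] := irreducible_divisor s1.
have p0 := irredp_neq0 irrp; have p1 : (1 < size p)%N := irrp.1.
have s'0 : s' != 0 by apply: contraNneq s0; rewrite es => ->; rewrite mul0r.
have ls' : (size s' <= n)%N.
  rewrite -ltnS (leq_trans _ le) // es size_mul //.
  by case: (size p) p1 => [|[|m]] // _; rewrite !addnS ltnS leq_addr.
have : pdvd p (P * Q).
  by move=> w; rewrite -e pwcoef_scalM es; apply/dvdp_mulr/dvdp_mulIr.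
case/pdvd_mul => // /(pdvdP p0)[T eT].
  have [|r1 [r2 [P' [Q' [eP eQ er eY]]]]] := IHn s' ls' Y T Q s'0.
    apply: (pmulfI (P := scal p)); rewrite ?scal_eq0 //.
    by rewrite mulrA -rmorphM /= [p * s']mulrC -es e eT mulrA.
  exists (p * r1), r2, P', Q'; split=> //; first by rewrite eT eP rmorphM mulrA.
  by rewrite es er mulrC mulrA.
have [|r1 [r2 [P' [Q' [eP eQ er eY]]]]] := IHn s' ls' Y P T s'0.
  apply: (pmulfI (P := scal p)); rewrite ?scal_eq0 //.
  by rewrite mulrA -rmorphM /= [p * s']mulrC -es e eT !mulrA scal_comm.
exists r1, (p * r2), P', Q'; split=> //; first by rewrite eT eQ rmorphM mulrA.
by rewrite es er mulrC mulrCA.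
Qed.

End PolyCoef.

(** * The generic fiber f - t over k(t) *)

Section GenericFiber.
Variables (k : fieldType) (d : nat) (A : freeAlgType k d).
Variables (E : fieldType) (j : {rmorphism {poly k} -> E}) (AE : freeAlgType E d).
Implicit Types (P Q Y : {poly A}) (p s : {poly k}) (w : seq 'I_d).

(** Extension of scalars from k[t] to E, which [j_inj] and [j_frac] below make its field of
    fractions. *)
Definition generic P : AE :=
  of_coeffs AE (\max_(i < size P) dg P`_i) (fun w => j (pwcoef w P)).

Lemma wcoef_generic w P : wcoef w (generic P) = j (pwcoef w P).
Proof.
rewrite wcoef_of_coeffs; case: ltnP => // le; suff -> : pwcoef w P = 0 by rewrite rmorph0.
apply/polyP => i; rewrite coef_pwcoef coef0.
case: (ltnP i (size P)) => [lt|/(nth_default _)->]; last exact: linear0.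
by rewrite wcoef_dg // (leq_trans _ le) // (leq_bigmax (Ordinal lt)).
Qed.

Fact generic_is_zmod_morphism : zmod_morphism generic.
Proof.
by move=> P Q; apply: eq_wcoef => w; rewrite linearB /= !wcoef_generic !raddfB.
Qed.
HB.instance Definition _ := GRing.isZmodMorphism.Build {poly A} AE generic
  generic_is_zmod_morphism.

Lemma generic_scal p : generic (scal A p) = (j p)%:A.
Proof.
apply: eq_wcoef => w; rewrite wcoef_generic pwcoef_scal; case: w => [|i w] /=.
  by rewrite wcoef_nil epsC.
by rewrite wcoef_cons transC linear0 rmorph0.
Qed.

Fact generic_is_monoid_morphism : monoid_morphism generic.
Proof.
split=> [|P Q]; first by rewrite -(rmorph1 (@scal _ _ A)) generic_scal rmorph1 scale1r.
apply: eq_wcoef => w; rewrite mulr_wcoef wcoef_generic pwcoefM rmorph_sum.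
by apply: eq_bigr => l _; rewrite rmorphM !wcoef_generic.
Qed.
HB.instance Definition _ := GRing.isMonoidMorphism.Build {poly A} AE generic
  generic_is_monoid_morphism.

Lemma generic_scalM p P : generic (scal A p * P) = j p *: generic P.
Proof. by rewrite rmorphM /= generic_scal mulr_algl. Qed.

Lemma generic_letter i : generic (letter i)%:P = letter i.
Proof.
apply: eq_wcoef => w; rewrite wcoef_generic pwcoefC; case: w => [|l w].
  by rewrite !wcoef_nil !eps_letter rmorph0.
rewrite !wcoef_cons !trans_letter; case: (i == l); last by rewrite !linear0 rmorph0.
case: w => [|l' w]; first by rewrite !wcoef_nil !rmorph1.
by rewrite !wcoef_cons !trans1 !linear0 rmorph0.
Qed.

Lemma dg_generic P N : (forall i, (dg P`_i <= N)%N) -> (dg (generic P) <= N)%N.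
Proof.
move=> H; rewrite leqNgt; apply/negP => lt.
have g0 : generic P != 0 by rewrite -dg_eq0 -lt0n (leq_trans _ lt).
have [w [+ e]] := dg_top g0; rewrite wcoef_generic.
suff -> : pwcoef w P = 0 by rewrite rmorph0 eqxx.
by apply/polyP => i; rewrite coef_pwcoef coef0 wcoef_dg // (leq_trans (H i)) // -ltnS -e.
Qed.

Hypothesis j_inj : injective j.

Lemma generic_inj : injective generic.
Proof.
by move=> P Q e; apply: eq_pwcoef => w; apply: j_inj; rewrite -!wcoef_generic e.
Qed.

Lemma j_eq0 p : (j p == 0) = (p == 0).
Proof. by rewrite -(inj_eq j_inj) rmorph0. Qed.

Lemma dg_genericC (g : A) : dg (generic g%:P) = dg g.
Proof.
apply/eqP; rewrite eqn_leq dg_generic /=; last first.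
  by move=> i; rewrite coefC; case: ifP => // _; rewrite dg0.
have [->|g0] := eqVneq g 0; first by rewrite dg0.
have [w [gw ->]] := dg_top g0; rewrite ltnNge; apply: contra gw => le.
have /eqP := wcoef_dg le; rewrite wcoef_generic pwcoefC j_eq0 polyC_eq0.
by [].
Qed.

Hypothesis j_frac : forall x, exists p s, s != 0 /\ j s * x = j p.

Lemma generic_clear (g : AE) : exists s P, s != 0 /\ j s *: g = generic P.
Proof.
elim: {g}(dg g) {-2}g (leqnn (dg g)) => [|n IHn] g le.
  exists 1, 0; rewrite oner_neq0 rmorph0; split=> //.
  by move: le; rewrite leqn0 dg_eq0 => /eqP->; rewrite scaler0.
have [p0 [s0 [s0n e0]]] := j_frac (eps g).
have /choice[s Hs] := fun i => IHn _ (dg_trans i le).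
have /choice[P HP] := Hs.
exists (s0 * \prod_i s i).
exists (scal A (\prod_i s i * p0) +
  \sum_i scal A (s0 * \prod_(l | l != i) s l) * ((letter i)%:P * P i)).
split.
  by rewrite mulf_neq0 //; apply/prodf_neq0 => i _; case: (HP i).
rewrite rmorphD /= generic_scal rmorph_sum /= {1}(trans_decomp g) scalerDr scalerA.
have -> : j (s0 * \prod_i s i) * eps g = j (\prod_i s i * p0).
  by rewrite rmorphM mulrAC e0 -rmorphM mulrC.
congr (_ + _); rewrite scaler_sumr; apply: eq_bigr => i _.
rewrite generic_scalM (rmorphM generic) /= generic_letter -(HP i).2 -scalerAr scalerA -rmorphM /=.
by congr (j _ *: _); rewrite (bigD1 i) //= mulrCA mulrC.
Qed.

(** After the denominators of a and b are cleared, [gauss_split] distributes their product over the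
    two factors; c is what remains to be moved across. *)
Lemma gauss Y (a b : AE) : Y != 0 -> generic Y = a * b ->
  exists c P Q, [/\ c != 0, c *: a = generic P, c^-1 *: b = generic Q & Y = P * Q].
Proof.
move=> Y0 e.
have [s1 [P0 [s10 eP]]] := generic_clear a; have [s2 [Q0 [s20 eQ]]] := generic_clear b.
have : scal A (s1 * s2) * Y = P0 * Q0.
  apply: generic_inj; rewrite generic_scalM !rmorphM /= e -eP -eQ.
  by rewrite -scalerAl -scalerAr scalerA.
case/gauss_split; first exact: mulf_neq0.
move=> r1 [r2 [P [Q [eP0 eQ0 ers eY]]]].
have rn : r1 * r2 != 0 by rewrite -ers mulf_neq0.
have r1n : r1 != 0 by apply: contraNneq rn => ->; rewrite mul0r.
have r2n : r2 != 0 by apply: contraNneq rn => ->; rewrite mulr0.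
have jn p : p != 0 -> j p != 0 by rewrite j_eq0.
exists (j s1 / j r1), P, Q; split=> //.
- by rewrite mulf_neq0 ?invr_eq0 ?jn.
- by rewrite mulrC -scalerA eP eP0 generic_scalM scalerA mulVf ?jn // scale1r.
- rewrite invf_div; apply: (scalerI (jn _ r2n)); rewrite -generic_scalM -eQ0 -eQ scalerA.
  congr (_ *: _); apply: (mulfI (jn _ s10)); rewrite mulrCA [j s1 * (_ / _)]mulrC divfK ?jn //.
  by rewrite mulrC -!rmorphM ers.
Qed.

Variable f : A.

(** By Gauss' lemma the factors may be taken in [{poly A}]. As f - t is linear in t with leading
    coefficient - 1, one factor is free of t and divides - 1, so it is a constant. *)
Lemma generic_fiber_irreducible (a b : AE) :
  fiber (generic f%:P) (j 'X) = a * b -> (dg a <= 1)%N \/ (dg b <= 1)%N.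
Proof.
have -> : fiber (generic f%:P) (j 'X) = generic (f%:P - 'X).
  by rewrite rmorphB /= -[in generic 'X](scalX A) generic_scal.
have Y1 : (f%:P - 'X)`_1 = - 1 :> A by rewrite coefB coefC coefX sub0r.
have Y0 : f%:P - 'X != 0 :> {poly A}.
  by apply/eqP => e; move/eqP: Y1; rewrite e coef0 eq_sym oppr_eq0 oner_eq0.
have sY : size (f%:P - 'X : {poly A}) = 2%N.
  by rewrite -opprB size_polyN size_XsubC.
case/(gauss Y0) => c [P [Q [c0 eP eQ eY]]].
have P0 : P != 0 by apply: contraNneq Y0 => P0; rewrite eY P0 mul0r.
have Q0 : Q != 0 by apply: contraNneq Y0 => Q0; rewrite eY Q0 mulr0.
have : (size P + size Q = 3)%N.
  by have := psize_mul P0 Q0; rewrite -eY sY; case: (_ + _)%N => [|n] //= <-.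
have cst (x : AE) (e : E) (g : A) : e != 0 -> e *: x = generic g%:P ->
    (dg g <= 1)%N -> (dg x <= 1)%N.
  move=> e0 ex le; rewrite -[x](scalerK e0) ex; apply: dgZ.
  by rewrite dg_genericC.
have [sP|sP] := leqP (size P) 1.
  move=> _; left; have ePc := size1_polyC sP; rewrite ePc in eP.
  apply: cst eP _ => //.
  have e1 : P`_0 * Q`_1 = - 1 by rewrite -Y1 eY [P in RHS]ePc coefCM.
  by have [|-> _] := @dg_unit _ _ _ (P`_0) (- Q`_1); rewrite // mulrN e1 opprK.
move=> sPQ; right; have sQ : (size Q <= 1)%N.
  by have : (2 + size Q <= 3)%N by rewrite -sPQ leq_add2r.
have eQc := size1_polyC sQ; rewrite eQc in eQ.
apply: cst eQ _; first by rewrite invr_eq0.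
have e1 : P`_1 * Q`_0 = - 1 by rewrite -Y1 eY [Q in RHS]eQc coefMC.
by have [|_ ->] := @dg_unit _ _ _ (- P`_1) (Q`_0); rewrite // mulNr e1 opprK.
Qed.

End GenericFiber.

(** * Infinitely many reducible fibers enlarge the centralizer *)

Section RealizationExists.
Variables (F : fieldType) (d : nat) (A : freeAlgType F d).
Implicit Types (f g x y : A) (w : seq 'I_d).

Lemma linear_combination_span q (v : 'I_q -> A) (P : A -> Prop) :
  P 0 -> (forall g h, P g -> P h -> P (g + h)) -> (forall c g, P g -> P (c *: g)) ->
  (forall j, P (v j)) -> forall z, P (vec v z).
Proof.
move=> P0 PD PZ Pv z; rewrite /vec; elim/big_ind: _ => // j _.
exact: PZ.
Qed.

(** Gaussian elimination with the words [wl] as pivots. That the v j lie in the span of xs is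
    phrased as an induction principle, ready for any linear property. *)
Lemma echelon_basis (xs : seq A) :
  exists (q : nat) (v : 'I_q -> A) (wl : 'I_q -> seq 'I_d),
  [/\ forall j l, wcoef (wl l) (v j) = (j == l)%:R,
      forall x, x \in xs -> exists z, x = vec v z &
      forall P : A -> Prop, P 0 -> (forall g h, P g -> P h -> P (g + h)) ->
        (forall c g, P g -> P (c *: g)) -> (forall x, x \in xs -> P x) -> forall j, P (v j)].
Proof.
elim: xs => [|x xs [q [v [wl [dual span gen]]]]].
  by exists 0%N, (fun=> 0), (fun=> [::]); split=> [[]|//|? ? ? ? ? []].
have coord l z : wcoef (wl l) (vec v z) = z 0 l.
  rewrite linear_sum (bigD1 l) //= linearZ /= dual eqxx mulr1 big1 ?addr0 // => j /negbTE jl.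
  by rewrite linearZ /= dual jl mulr0.
pose x' := x - vec v (\row_l wcoef (wl l) x).
have x'0 l : wcoef (wl l) x' = 0 by rewrite linearB /= coord mxE subrr.
have [e|/dg_top[w [cw _]]] := eqVneq x' 0.
  exists q, v, wl; split=> // [y|P P0 PD PZ Px]; last first.
    by apply: gen => // y ys; apply: Px; rewrite inE ys orbT.
  rewrite inE => /orP[/eqP->|/span//]; exists (\row_l wcoef (wl l) x).
  by apply/eqP; rewrite -subr_eq0 -/x' e.
pose y := (wcoef w x')^-1 *: x'.
have yw : wcoef w y = 1 by rewrite linearZ /= mulVf.
have yl l : wcoef (wl l) y = 0 by rewrite linearZ /= x'0 mulr0.
pose v' j := v j - wcoef w (v j) *: y.
pose vv (i : 'I_q.+1) := if unlift ord0 i is Some j then v' j else y.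
pose ww (i : 'I_q.+1) := if unlift ord0 i is Some j then wl j else w.
pose rep g := exists z, g = vec vv z.
have repD g h : rep g -> rep h -> rep (g + h).
  by move=> [a ->] [b ->]; exists (a + b); rewrite linearD.
have repZ c g : rep g -> rep (c *: g).
  by move=> [a ->]; exists (c *: a); rewrite linearZ.
have repv i : rep (vv i).
  exists (delta_mx 0 i); rewrite /vec (bigD1 i) //= mxE !eqxx scale1r big1 ?addr0 //.
  by move=> j /negbTE ji; rewrite mxE ji scale0r.
have repy : rep y by have := repv ord0; rewrite /vv unlift_none.
have repv0 j : rep (v j).
  have -> : v j = v' j + wcoef w (v j) *: y by rewrite subrK.
  by apply/repD/repZ => //; have := repv (lift ord0 j); rewrite /vv liftK.
have rep_old z : rep (vec v z).
  by apply: linear_combination_span => //; exists 0; rewrite linear0.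
exists q.+1, vv, ww; split.
- move=> i l; rewrite /vv /ww.
  case: (unliftP ord0 i) => [i' ->|->]; case: (unliftP ord0 l) => [l' ->|->].
  + by rewrite linearB /= linearZ /= yl mulr0 subr0 dual (inj_eq lift_inj).
  + by rewrite linearB /= linearZ /= yw mulr1 subrr.
  + by rewrite yl (negbTE (neq_lift _ _)).
  + by rewrite yw eqxx.
- move=> g; rewrite inE => /orP[/eqP->|/span[z ->]]; last exact: rep_old.
  have -> : x = vec v (\row_l wcoef (wl l) x) + wcoef w x' *: y.
    by rewrite scalerA mulfV // scale1r addrC subrK.
  by apply: repD => //; apply: repZ.
- move=> P P0 PD PZ Px.
  have Pv j : P (v j) by apply: gen => // g gs; apply: Px; rewrite inE gs orbT.
  have Py : P y.
    apply/PZ/PD; first by apply: Px; rewrite inE eqxx.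
    by rewrite -scaleN1r; apply: (PZ); apply: linear_combination_span.
  move=> i; rewrite /vv; case: unlift => [j|//].
  by apply: PD => //; rewrite -scaleN1r; apply/PZ/PZ.
Qed.

Fixpoint short_words n : seq (seq 'I_d) :=
  if n is n'.+1 then [::] :: [seq i :: w | i <- enum 'I_d, w <- short_words n'] else [:: [::]].

Lemma mem_short_words n w : (size w <= n)%N -> w \in short_words n.
Proof.
elim: n w => [|n IHn] [|i w] //= le.
by rewrite inE; apply/orP; right; apply/allpairsP; exists (i, w); rewrite mem_enum IHn.
Qed.

(** Long words annihilate f, so finitely many transductions span V. Stripping a top word of f leaves
    a nonzero constant, so V contains 1. *)
Lemma realization_exists f : eps f = 0 -> (1 < dg f)%N ->
  exists q (v : 'I_q -> A) N b o wl, realization f v N b o wl.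
Proof.
move=> f0 f1; pose ws := [seq w <- short_words (dg f) | w != [::]].
have [q [v [wl [dual span gen]]]] := echelon_basis [seq transw w f | w <- ws].
pose rep g := exists z, g = vec v z.
have rep0 : rep 0 by exists 0; rewrite linear0.
have repD g h : rep g -> rep h -> rep (g + h).
  by move=> [a ->] [b ->]; exists (a + b); rewrite linearD.
have repZ c g : rep g -> rep (c *: g).
  by move=> [a ->]; exists (c *: a); rewrite linearZ.
have repw w : w != [::] -> rep (transw w f).
  move=> w0; have [le|lt] := leqP (size w) (dg f).
    by apply/span/map_f; rewrite mem_filter w0 mem_short_words.
  by rewrite transw_dg // ltnW.
have fn0 : f != 0 by rewrite -dg_eq0 -lt0n ltnW.
have [w [cw dgw]] := dg_top fn0.
have w0 : w != [::] by apply: contraTneq f1 => w0; rewrite dgw w0.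
have [o oE] : rep 1.
  have /dg_le1 e : (dg (transw w f) <= 1)%N by apply: dg_transw; rewrite dgw addn1.
  have -> : 1 = (wcoef w f)^-1 *: transw w f by rewrite e scalerA mulVf ?scale1r.
  exact/repZ/repw.
have repT i j : rep (trans i (v j)).
  apply: (gen (fun g => rep (trans i g))) => [|g h|c g|x /mapP[u]].
  - by rewrite linear0.
  - by rewrite linearD; apply: repD.
  - by rewrite linearZ; apply: repZ.
  - rewrite mem_filter => /andP[u0 _] ->.
    have := repw (rcons u i); rewrite /transw foldl_rcons; apply.
    by case: (u).
have /choice[N HN] : forall i, exists X : 'M_q, forall j, trans i (v j) = vec v (row j X).
  move=> i; have /choice[z zE] := repT i; exists (\matrix_j z j) => j.
  by rewrite rowK zE.
have /choice[b bE] : forall i, rep (trans i f) by move=> i; apply: (repw [:: i]).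
exists q, v, N, b, o, wl; split=> //.
- pose P g := exists s : seq (F * seq 'I_d),
    all (fun p => p.2 != [::]) s /\ g = \sum_(p <- s) p.1 *: transw p.2 f.
  apply: (gen P) => [|g h|c g|x /mapP[u]].
  + by exists [::]; rewrite big_nil.
  + move=> [s [sP ->]] [s' [s'P ->]]; exists (s ++ s'); rewrite all_cat sP s'P.
    by rewrite big_cat.
  + move=> [s [sP ->]]; exists [seq (c * p.1, p.2) | p <- s]; rewrite all_map; split=> //.
    by rewrite big_map scaler_sumr; apply: eq_bigr => p _; rewrite scalerA.
  + rewrite mem_filter => /andP[u0 _] ->; exists [:: (1, u)].
    by rewrite /= u0 big_seq1 scale1r.
- move=> j; apply: (gen (fun g => (dg g < dg f)%N)) => [|g h|c g|x /mapP[u]].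
  + by rewrite dg0 ltnW.
  + by case: (dg f) => // n; rewrite !ltnS; apply: dgD.
  + by case: (dg f) => // n; rewrite !ltnS; apply: dgZ.
  + rewrite mem_filter => /andP[u0 _] ->; case E: (dg f) f1 => [|n] // _.
    rewrite ltnS; apply: dg_transw; rewrite E.
    by case: u u0 => //= i u _; rewrite addSn ltnS leq_addl.
Qed.

End RealizationExists.

Section RealizationBaseChange.
Variables (k L : fieldType) (iota : {rmorphism k -> L}) (d : nat).
Variables (A : freeAlgType k d) (A' : freeAlgType L d) (f : A) (q : nat) (v : 'I_q -> A).
Variables (N : 'I_d -> 'M[k]_q) (b : 'I_d -> 'rV[k]_q) (o : 'rV[k]_q) (wl : 'I_q -> seq 'I_d).
Hypothesis rV : realization f v N b o wl.

Local Notation bc := (base_change iota A').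

Lemma vec_base_change z : vec (bc \o v) (map_mx iota z) = bc (vec v z).
Proof.
rewrite /vec rmorph_sum; apply: eq_bigr => j _.
by rewrite /= base_changeZ mxE.
Qed.

Lemma realization_base_change :
  realization (bc f) (bc \o v) (fun i => map_mx iota (N i)) (fun i => map_mx iota (b i))
    (map_mx iota o) wl.
Proof.
split=> [j l|j|i j|i||j] /=.
- by rewrite wcoef_base_change (real_dual rV) rmorph_nat.
- have [s [sP ->]] := real_span rV j; exists [seq (iota x.1, x.2) | x <- s].
  rewrite all_map; split=> //; rewrite big_map rmorph_sum; apply: eq_bigr => x _.
  by rewrite /= base_changeZ transw_base_change.
- by rewrite -map_row vec_base_change trans_base_change (real_trans rV).
- by rewrite vec_base_change trans_base_change (real_base rV).
- by rewrite vec_base_change (real_one rV) rmorph1.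
- by rewrite !dg_base_change ?(real_dg rV) //; apply: fmorph_inj.
Qed.

Lemma shift_mx_base_change t i :
  shift_mx t (bc \o v) (fun i => map_mx iota (N i)) (fun i => map_mx iota (b i)) i =
  t *: map_mx iota (N i) + map_mx iota ((\col_j eps (v j)) *m b i).
Proof.
rewrite /shift_mx map_mxM; congr (_ + _ *m _).
by apply/colP => j; rewrite !mxE /= eps_base_change.
Qed.

End RealizationBaseChange.

Lemma infinite_not_root (L : fieldType) (S : set L) (r : {poly L}) :
  infinite_set S -> r != 0 -> exists2 x, S x & ~~ root r x.
Proof.
move=> infS r0; apply: contrapT => H.
have [B BS sB] := infinite_set_fset (size r) infS.
have : (#|` B| < size r)%N.
  apply: max_poly_roots => //; last exact: fset_uniq.
  by apply/allP => x xB; apply/contraT => nx; case: H; exists x => //; apply: BS.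
by rewrite ltnNge sB.
Qed.

Section Spectral.
Variables (k : fieldType) (d : nat) (A : freeAlgType k d).
Variables (E : fieldType) (j : {rmorphism {poly k} -> E}) (AE : freeAlgType E d).
Hypothesis j_inj : injective j.
Hypothesis j_frac : forall x, exists p s, s != 0 /\ j s * x = j p.
Variables (L : fieldType) (iota : {rmorphism k -> L}) (A' : freeAlgType L d).
Variable f : A.
Hypotheses (f0 : eps f = 0) (f_deg : (1 < dg f)%N).

Lemma generic_constE (g : A) : base_change (j \o polyC) AE g = generic j AE g%:P.
Proof.
by apply: eq_wcoef => w; rewrite wcoef_base_change wcoef_generic pwcoefC.
Qed.

Lemma infinite_factor_centralizer :
  infinite_set [set lambda : L | exists a c : A',
    [/\ fiber (base_change iota A' f) lambda = a * c, (1 < dg a)%N & (1 < dg c)%N]] ->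
  exists g, GRing.comm f g /\ forall p, g <> (map_poly (in_alg A) p).[f].
Proof.
move=> infS.
have [q [v [N [b [o [wl rV]]]]]] := realization_exists f0 f_deg.
pose t := j 'X; have t0 : t != 0 by rewrite (j_eq0 j_inj) polyX_eq0.
pose fE : AE := generic j AE f%:P.
have rE := realization_base_change (j \o polyC) AE rV; rewrite generic_constE -/fE in rE.
set vE := (_ \o v) in rE; set NE := fun i => map_mx _ (N i) in rE.
set bE := fun i => map_mx _ (b i) in rE; set oE := map_mx _ o in rE.
have fE0 : eps fE = 0 by rewrite /fE -generic_constE eps_base_change f0 rmorph0.
have dgE : dg fE = dg f by apply: dg_genericC.
pose M := shift_mx t vE NE bE.
have irr (B : 'M_q) : (forall i, B *m M i <= B)%MS -> B != 0 -> row_full B.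
  move=> sB B0; apply/contraT => nfB.
  have [a [c [e a1 c1]]] := stable_factor fE0 t0 rE sB B0 nfB.
  by case: (generic_fiber_irreducible j_inj j_frac e); rewrite leqNgt ?a1 ?c1.
have [cent|] := pselect (forall Z : 'M_q, (forall i, Z *m M i = M i *m Z) -> exists c, Z = c%:M).
  exfalso.
  (* A common model over k[t], which gives M over E and, at t = lambda, the shift matrices of the
     fiber over L. *)
  pose Mp i : 'M[{poly k}]_q :=
    'X *: map_mx polyC (N i) + map_mx polyC ((\col_l eps (v l)) *m b i).
  have MpE i : map_mx j (Mp i) = M i.
    by rewrite /M shift_mx_base_change map_mxD map_mxZ -!map_mx_comp.
  have spec X : word_span M X -> exists s (l : seq ({poly k} * seq 'I_d)), s != 0 /\
      j s *: X = map_mx j (\sum_(x <- l) x.1 *: word_mx Mp x.2).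
    move=> [l ->]; elim: l => [|[c w] l [s [l' [s0 e]]]].
      by exists 1, [::]; rewrite oner_neq0 !big_nil scaler0 map_mx0.
    have [p [s' [s'0 e']]] := j_frac c.
    exists (s * s'), ((s * p, w) :: [seq (s' * x.1, x.2) | x <- l']).
    rewrite mulf_neq0 //; split=> //; rewrite !big_cons big_map scalerDr map_mxD /=.
    congr (_ + _).
      by rewrite scalerA map_mxZ (map_word_mx _ MpE) !rmorphM -mulrA e'.
    rewrite rmorphM mulrC -scalerA e -map_mxZ scaler_sumr.
    by under [in RHS]eq_bigr do rewrite -scalerA.
  have /choice[s Hs] := fun x : 'I_q * 'I_q =>
    spec (delta_mx x.1 x.2) (word_span_full irr cent _).
  (* Outside the roots of this polynomial all denominators survive; the factor ['X] keeps lambda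
     nonzero, as the shifts require. *)
  have r0 : map_poly iota ('X * \prod_x s x) != 0.
    rewrite map_poly_eq0 mulf_neq0 ?polyX_eq0 //; apply/prodf_neq0 => x _.
    by have [l []] := Hs x.
  have [lambda [a [c [e a1 c1]]]] := infinite_not_root infS r0.
  rewrite /root rmorphM rmorph_prod hornerM horner_prod /= map_polyX hornerX.
  rewrite mulf_eq0 negb_or => /andP[l0 /prodf_neq0 sl].
  pose ev : {rmorphism {poly k} -> L} := horner_eval lambda \o map_poly iota.
  have rL := realization_base_change iota A' rV.
  have fL0 : eps (base_change iota A' f) = 0 by rewrite eps_base_change f0 rmorph0.
  have [X] := factor_not_full fL0 l0 rL e a1 c1; apply.
  set ML := shift_mx _ _ _ _.
  have MLE i : map_mx ev (Mp i) = ML i.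
    rewrite /ML shift_mx_base_change map_mxD map_mxZ -!map_mx_comp /=.
    rewrite /horner_eval map_polyX hornerX; congr (_ *: _ + _).
      by apply/matrixP => x y; rewrite !mxE /= map_polyC hornerC.
    by apply/matrixP => x y; rewrite !mxE /= map_polyC hornerC.
  rewrite (matrix_sum_delta X); apply: word_span_sum => x; apply: word_span_sum => y.
  apply: word_spanZ; have [l [s0 es]] := Hs (x, y).
  have : s (x, y) *: delta_mx x y = \sum_(x <- l) x.1 *: word_mx Mp x.2.
    suff eM : map_mx j (s (x, y) *: delta_mx x y) = map_mx j (\sum_(x <- l) x.1 *: word_mx Mp x.2).
      apply/matrixP => x' y'; apply: j_inj.
      by have /matrixP/(_ x' y') := eM; rewrite [LHS]mxE [RHS]mxE.
    by rewrite -es map_mxZ map_delta_mx.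
  move/(congr1 (map_mx ev)); rewrite map_mxZ map_delta_mx raddf_sum /= => eL.
  have evs : ev (s (x, y)) != 0 by apply: sl.
  rewrite -[delta_mx x y](scalerK evs) eL; apply/word_spanZ.
  exists [seq (ev u.1, u.2) | u <- l]; rewrite big_map; apply: eq_bigr => u _.
  by rewrite map_mxZ (map_word_mx _ MLE).
move=> ncent; have [Z [ZC nZ]] : exists Z : 'M_q,
    (forall i, Z *m M i = M i *m Z) /\ forall c, Z <> c%:M.
  apply: contrapT => H; apply: ncent => Z ZC; apply: contrapT => nZ; apply: H.
  by exists Z; split=> // c e; apply: nZ; exists c.
have [[e' eE] scalarZ] := commuting_endo fE0 t0 rE ZC.
set e := vec vE _ in eE scalarZ.
have dge : (dg e < dg fE)%N := dg_vec rE _.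
have [s1 [P [s10 PE]]] := generic_clear A j_frac e.
have [s2 [P' [s20 P'E]]] := generic_clear A j_frac e'.
pose U := scal A s2 * P; pose U' := scal A s1 * P'.
have fibE : fiber fE t = generic j AE (f%:P - 'X).
  by rewrite rmorphB /= -[in generic _ _ 'X](scalX A) generic_scal.
have UE : generic j AE U = j (s2 * s1) *: e by rewrite generic_scalM -PE scalerA rmorphM.
have comU : (f%:P - 'X) * U = U' * (f%:P - 'X).
  apply: (generic_inj (AE := AE) j_inj).
  rewrite [LHS]rmorphM [RHS]rmorphM /= UE generic_scalM -P'E -fibE scalerA.
  by rewrite -scalerAl -scalerAr -eE -rmorphM mulrC.
exists U.[f]; split.
  (* Put t = f with coefficients on the left: the right side vanishes with its last factor f - t,
     and the left side becomes f U(f) - U(f) f. *)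
  have := congr1 (horner^~ f) comU.
  rewrite [RHS]hornerM_comm; last first.
    by rewrite /comm_poly hornerD hornerN hornerC hornerX subrr mul0r mulr0.
  rewrite [in RHS]hornerD hornerN hornerC hornerX subrr mulr0 mulrBl.
  rewrite -['X * U]commr_polyX hornerD hornerN hornerCM hornerMX.
  by move/eqP; rewrite subr_eq0 => /eqP.
move=> p ep.
(* If U(f) = p(f), then U - p is a left multiple of f - t, yet of smaller degree because e lies in
   V. So U = p, and e and hence Z would be scalar. *)
have /factor_theorem[Q QE] : root (U - scal A p) f.
  by rewrite /root hornerD hornerN ep subrr.
have gE : generic j AE (U - scal A p) = j (s2 * s1) *: e - (j p)%:A.
  by rewrite rmorphB /= UE generic_scal.
have small : (dg (generic j AE (U - scal A p)) < dg fE)%N.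
  move: dge f_deg; rewrite -dgE; case: (dg fE) => // n; rewrite !ltnS gE => le n0.
  by apply: dgB; [apply: dgZ|apply: leq_trans (dgC _ _) n0].
have {}gE : j (s2 * s1) *: e = (j p)%:A.
  apply/eqP; rewrite -subr_eq0 -gE; apply: contraLR small => n0.
  rewrite -leqNgt QE -opprB mulrN rmorphN rmorphM /= -fibE.
  have Q0 : generic j AE Q != 0.
    by apply: contraNneq n0 => Q0; rewrite QE rmorphM /= Q0 mul0r.
  have fib0 : fiber fE t != 0.
    by rewrite -dg_eq0 -lt0n (leq_trans _ (dg_fiber t rE)) // dgE ltnW.
  by rewrite -mulNr dgM_eq ?oppr_eq0 // (leq_trans (dg_fiber t rE)) // leq_addl.
have c0 : j (s2 * s1) != 0 by rewrite (j_eq0 j_inj) mulf_neq0.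
apply: (nZ ((j (s2 * s1))^-1 * j p)); apply: scalarZ.
by rewrite -[e](scalerK c0) gE scalerA.
Qed.

End Spectral.

(** * Bergman's centralizer theorem *)

Section Words.
Variables (R : comNzRingType) (d : nat) (A : freeAlgType R d).

Definition monomial (w : seq 'I_d) : A := foldr (fun i y => letter i * y) 1 w.

Lemma monomial_cat u v : monomial (u ++ v) = monomial u * monomial v.
Proof. by elim: u => [|i u IHu] /=; rewrite ?mul1r // IHu mulrA. Qed.

Lemma wcoef_monomial u w : wcoef u (monomial w) = (u == w)%:R.
Proof.
elim: w u => [|i w IHw] [|l u] /=.
- by rewrite wcoef_nil rmorph1.
- by rewrite wcoef_cons trans1 linear0.
- by rewrite wcoef_nil epsXM.
- rewrite wcoef_cons transXM eqseq_cons eq_sym; case: eqP => _ /=.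
    by rewrite mulr1n IHw.
  by rewrite mulr0n linear0.
Qed.

Lemma monomial_expansion n (g : A) : (dg g <= n.+1)%N ->
  g = \sum_(w <- short_words d n) wcoef w g *: monomial w.
Proof.
elim: n g => [|n IHn] g le.
  by rewrite big_seq1 wcoef_nil -dg_le1.
rewrite /= big_cons wcoef_nil /= big_allpairs_dep big_enum /= {1}(trans_decomp g).
congr (_ + _); apply: eq_bigr => i _.
rewrite {1}(IHn _ (dg_trans i le)) mulr_sumr; apply: eq_bigr => w _.
by rewrite -wcoef_cons scalerAr.
Qed.

End Words.

Lemma wcoefM_neq0 (R : comNzRingType) (d : nat) (A : freeAlgType R d) (y z : A) w :
  wcoef w (y * z) != 0 -> exists u v, [/\ w = u ++ v, wcoef u y != 0 & wcoef v z != 0].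
Proof.
move=> yz; apply: contrapT => H; case/eqP: yz; rewrite mulr_wcoef big1 // => l _.
have [->|yu] := eqVneq (wcoef (take l w) y) 0; first by rewrite mul0r.
have [->|zv] := eqVneq (wcoef (drop l w) z) 0; first by rewrite mulr0.
by case: H; exists (take l w), (drop l w); rewrite cat_take_drop.
Qed.

Lemma exists_max (T : eqType) (F : T -> rat) (r : seq T) : r != [::] ->
  exists2 x, x \in r & forall y, y \in r -> F y <= F x.
Proof.
elim: r => // x [|x' r] IHr _; first by exists x; rewrite ?mem_head // => y; rewrite inE => /eqP->.
have [//|m mr mm] := IHr.
have [le|lt] := leP (F x) (F m).
  exists m; first by rewrite inE mr orbT.
  by move=> y; rewrite inE => /orP[/eqP->|/mm].
exists x; rewrite ?mem_head // => y; rewrite inE => /orP[/eqP->//|/mm le].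
exact: le_trans le (ltW lt).
Qed.

(** * Slopes of words and leading faces *)

Section Slope.
Variables (d : nat) (s : rat).
Implicit Types (u v w : seq 'I_d).

(** Larger than every digit, and at least 2 even for d = 0, so that radix^n - 1 is positive for n >
    0. *)
Definition radix : nat := d.+2.
Definition digits w : nat := foldl (fun n i => n * radix + nat_of_ord i)%N 0%N w.

Lemma digits_foldl n w : foldl (fun n i => n * radix + nat_of_ord i)%N n w =
  (n * radix ^ size w + digits w)%N.
Proof.
elim/last_ind: w => [|w i IHw]; first by rewrite /= muln1 addn0.
by rewrite /digits !foldl_rcons IHw -/(digits w) size_rcons expnSr mulnA mulnDl addnA.
Qed.

Lemma digits_cat u v : digits (u ++ v) = (digits u * radix ^ size v + digits v)%N.
Proof. by rewrite /digits foldl_cat digits_foldl. Qed.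

Lemma digits_rcons u i : digits (rcons u i) = (digits u * radix + i)%N.
Proof. by rewrite /digits foldl_rcons. Qed.

Lemma digits_inj u v : size u = size v -> digits u = digits v -> u = v.
Proof.
elim/last_ind: u v => [|u i IHu] v; first by case: v.
case/lastP: v => [|v l]; first by rewrite size_rcons.
rewrite !size_rcons !digits_rcons => -[sz] e.
have lt (x : 'I_d) : (x < radix)%N.
  exact: leq_trans (ltn_ord x) (leq_trans (leqnSn d) (leqnSn _)).
have radix0 : (0 < radix)%N by [].
have ei : i = l.
  apply/val_inj; have := congr1 (modn^~ radix) e.
  by rewrite /= !modnMDl !modn_small.
have eu : digits u = digits v.
  by have := congr1 (divn^~ radix) e; rewrite /= !divnMDl // !divn_small // !addn0.
by rewrite ei (IHu v).
Qed.

(* Reading w as the digits of an integer, [digits w / (radix^|w| - 1)] is the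
   value 0,www... of the periodic expansion of w; excess w has the sign of its
   comparison with s. *)
Definition excess w : rat := (digits w)%:R - s * ((radix ^ size w)%:R - 1).

Lemma excess_nil : excess [::] = 0.
Proof. by rewrite /excess /= expn0 subrr mulr0 subrr. Qed.

(** The weight of [excess u] is positive. So words of excess at most 0 form a monoid, and a
    concatenation attains the bound only if both parts do: this makes the face multiplicative. *)
Lemma excess_cat u v : excess (u ++ v) = (radix ^ size v)%:R * excess u + excess v.
Proof. by rewrite /excess digits_cat size_cat expnD natrD !natrM; ring. Qed.

Lemma excess_inj u v : size u = size v -> excess u = excess v -> u = v.
Proof.
move=> sz; rewrite /excess sz => /addIr/eqP; rewrite eqr_nat => /eqP.
exact: digits_inj.
Qed.

Variables (k : fieldType) (A : freeAlgType k d).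
Implicit Types (y z : A) (c : rat).

(** Sends a word of excess c to the power of tau given by its length, and other words to 0. By
    [excess_inj] each length has at most one such word, so no coefficients get mixed. *)
Definition face c y : {poly k} :=
  \poly_(n < dg y) \sum_(u : n.-tuple 'I_d | excess u == c) wcoef u y.

Lemma coef_face c y n :
  (face c y)`_n = \sum_(u : n.-tuple 'I_d | excess u == c) wcoef u y.
Proof.
rewrite coef_poly; case: ltnP => // le; rewrite big1 // => u _.
by rewrite wcoef_dg ?size_tuple.
Qed.

Fact face_is_linear c : GRing.linear_for *:%R (face c).
Proof.
move=> a y z; apply/polyP => n; rewrite coefD coefZ !coef_face mulr_sumr -big_split.
by apply: eq_bigr => u _; rewrite linearP.
Qed.
HB.instance Definition _ c :=
  GRing.isLinear.Build k A {poly k} *:%R (face c) (face_is_linear c).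

Lemma coef_face_word c y w : excess w = c -> (face c y)`_(size w) = wcoef w y.
Proof.
move=> ew; rewrite coef_face (bigD1 (in_tuple w)) /= ?ew // big1 ?addr0 // => u.
case/andP => /eqP eu; rewrite -val_eqE /= => /eqP[]; apply: excess_inj.
  by rewrite size_tuple.
by rewrite eu.
Qed.

Lemma face_monomial c w : face c (monomial A w) = if excess w == c then 'X^(size w) else 0.
Proof.
apply/polyP => n; rewrite coef_face.
have [nw|nw] := eqVneq n (size w); last first.
  rewrite big1 => [|u _]; first by case: ifP; rewrite ?coef0 // coefXn (negbTE nw).
  rewrite wcoef_monomial; case: eqP => // e.
  by rewrite -e size_tuple eqxx in nw.
rewrite nw; case: eqP => ew; last first.
  rewrite big1 ?coef0 // => u /eqP eu; rewrite wcoef_monomial; case: eqP => // e.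
  by case: ew; rewrite -e.
rewrite coefXn eqxx -[RHS](_ : wcoef w (monomial A w) = 1); last by rewrite wcoef_monomial eqxx.
by rewrite -(coef_face_word _ ew) coef_face.
Qed.

Definition below c y := forall w, wcoef w y != 0 -> excess w <= c.

Lemma face_mul c y z : below 0 y -> below c z -> face c (y * z) = face 0 y * face c z.
Proof.
move=> By Bz; rewrite {1 2}(monomial_expansion (leqnSn (dg y))).
rewrite {1 2}(monomial_expansion (leqnSn (dg z))).
rewrite mulr_suml !linear_sum mulr_suml /=; apply: eq_bigr => u _.
rewrite mulr_sumr linear_sum mulr_sumr /=; apply: eq_bigr => v _.
rewrite -scalerAl -scalerAr -monomial_cat !linearZ /= -scalerAl -scalerAr !face_monomial.
have [->|yu] := eqVneq (wcoef u y) 0; first by rewrite !scale0r.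
have [->|zv] := eqVneq (wcoef v z) 0; first by rewrite !scale0r.
congr (_ *: (_ *: _)); rewrite excess_cat size_cat.
have := By u yu; have := Bz v zv; rewrite !le_eqVlt.
have B0 : 0 < (radix ^ size v)%:R :> rat by rewrite ltr0n expn_gt0.
case/orP => [/eqP ev|lv]; case/orP => [/eqP eu|lu].
- by rewrite eu ev mulr0 add0r !eqxx exprD.
- rewrite ev (lt_eqF lu) mul0r lt_eqF // -subr_lt0 addrK.
  by rewrite pmulr_rlt0.
- by rewrite eu mulr0 add0r (lt_eqF lv) mulr0.
- rewrite (lt_eqF lu) mul0r lt_eqF // -[c]add0r ltrD //.
  by rewrite pmulr_rlt0.
Qed.

Lemma face_eq0 c y : (forall w, wcoef w y != 0 -> excess w < c) -> face c y = 0.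
Proof.
move=> H; apply/polyP => n; rewrite coef_face coef0 big1 // => u /eqP eu.
by apply/eqP/contraT => /H; rewrite eu ltxx.
Qed.

(** A nonempty right factor multiplies the negative excess of the left one by at least the radix and
    pushes it strictly below c, so only the constant term of z contributes. *)
Lemma face_mul_below c y z : c < 0 -> below c y -> below 0 z ->
  face c (y * z) = eps z *: face c y.
Proof.
move=> c0 By Bz; rewrite [in LHS](trans_decomp z) mulrDr linearD /=.
rewrite -scalerAr mulr1 linearZ /= [X in _ + X]face_eq0 ?addr0 // => w.
case/wcoefM_neq0 => u [v [-> yu zv]]; rewrite excess_cat.
have v0 : v != [::].
  apply: contraNneq zv => ->; rewrite wcoef_nil raddf_sum big1 // => i _.
  exact: epsXM.
have zv' : wcoef v z != 0.
  rewrite (trans_decomp z) linearD /=; case: v v0 zv => // i v _ zv.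
  by rewrite wcoef_cons transC linear0 add0r.
apply: le_lt_trans (lerD (ler_wpM2l _ (By u yu)) (Bz v zv')) _ => //.
rewrite addr0 -subr_lt0 -{2}[c]mul1r -mulrBl pmulr_rlt0 // subr_gt0 ltr1n.
by rewrite -(expn0 radix) ltn_exp2l //; case: v v0 {zv zv'}.
Qed.

Lemma below_mul y z : below 0 y -> below 0 z -> below 0 (y * z).
Proof.
move=> By Bz w /wcoefM_neq0[u [v [-> yu zv]]]; rewrite excess_cat.
by rewrite -[0]addr0 lerD ?Bz // pmulr_rle0 ?By // ltr0n expn_gt0.
Qed.

Lemma belowB c y z : below c y -> below c z -> below c (y - z).
Proof.
move=> By Bz w; rewrite linearB /=; have [yw|/By//] := eqVneq (wcoef w y) 0.
have [zw|/Bz//] := eqVneq (wcoef w z) 0.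
by rewrite yw zw subrr eqxx.
Qed.

Lemma below1 : below 0 (1 : A).
Proof.
case=> [|i w]; first by rewrite excess_nil.
by rewrite wcoef_cons trans1 linear0 eqxx.
Qed.

Lemma face1 : face 0 1 = 1.
Proof. by have := face_monomial 0 [::]; rewrite excess_nil eqxx expr0. Qed.

(* On the leading face of y, multiplication by g on the left is face 0 g and on
   the right only eps g. *)
Lemma face_inj g y : below 0 g -> face 0 g != (eps g)%:P -> below 0 y ->
  y * g = g * y -> face 0 y = 0 -> y = 0.
Proof.
move=> Bg gn By yg y0; apply/eqP/contraT => yn.
pose ws := [seq w <- short_words d (dg y) | wcoef w y != 0].
have wsP w : wcoef w y != 0 -> w \in ws.
  move=> yw; rewrite mem_filter yw mem_short_words // leqNgt.
  by apply: contra yw => lt; rewrite wcoef_dg // ltnW.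
have [v0 [yv0 maxv]] : exists v, wcoef v y != 0 /\ forall w, wcoef w y != 0 -> excess w <= excess v.
  have [w [/wsP yw _]] := dg_top yn.
  have [|v vs mv] := @exists_max _ excess ws; first by apply: contraTneq yw => ->.
  exists v; split; first by move: vs; rewrite mem_filter => /andP[].
  by move=> u /wsP/mv.
set c := excess v0.
have c0 : c < 0.
  rewrite lt_neqAle By // andbT; apply: contraNneq yv0 => e.
  by rewrite -(coef_face_word y e) y0 coef0.
have cn : face c y != 0.
  by apply: contraNneq yv0 => e; rewrite -(coef_face_word y (erefl c)) e coef0.
have /eqP : face 0 g * face c y = eps g *: face c y by rewrite -face_mul // -yg face_mul_below.
rewrite -mul_polyC -subr_eq0 -mulrBl mulf_eq0 (negbTE cn) orbF subr_eq0.
by rewrite (negbTE gn).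
Qed.

End Slope.

(** * The pencil of a commuting pair and its generator *)

Section Bergman.
Variables (k : fieldType) (d : nat) (A : freeAlgType k d).
Variables (E : fieldType) (j : {rmorphism {poly k} -> E}) (AE : freeAlgType E d).
Hypothesis j_inj : injective j.
Hypothesis j_frac : forall x, exists p s, s != 0 /\ j s * x = j p.

Section Pencil.
Variables (f g : A) (s : rat).
Hypothesis fg : f * g = g * f.
Hypotheses (below_f : below s 0 f) (below_g : below s 0 g).
Hypothesis face_g : face s 0 g != (eps g)%:P.

Local Notation phi := (@face d s k A 0).
Local Notation generic := (generic j AE).

Lemma coef0_face y : (phi y)`_0 = eps y.
Proof. by rewrite ((@coef_face_word d s k A 0 y [::])) // excess_nil. Qed.

Lemma size_face_g : (1 < size (phi g))%N.
Proof.
rewrite ltnNge; apply: contra face_g => /size1_polyC->.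
by rewrite coef0_face.
Qed.

(** Modulo a left ideal containing this element, c acts on 1 as the scalar phi(c). *)
Definition pencil (c : A) : {poly A} := c%:P - scal A (phi c).

Lemma pencilB a b : pencil (a - b) = pencil a - pencil b.
Proof. by rewrite /pencil polyCB linearB raddfB /= opprD addrACA -opprD. Qed.

Lemma pencil1 : pencil 1 = 0.
Proof. by rewrite /pencil face1 polyC1 rmorph1 subrr. Qed.

Lemma pencilZ x a : pencil (x *: a) = scal A x%:P * pencil a.
Proof.
by rewrite /pencil mulrBr -rmorphM /= mul_polyC linearZ /= scalC -polyCM mulr_algl.
Qed.

Lemma pencilM a b : below s 0 a -> below s 0 b ->
  pencil (a * b) = a%:P * pencil b + scal A (phi b) * pencil a.
Proof.
move=> Ba Bb; rewrite /pencil face_mul // polyCM rmorphM /= !mulrBr.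
rewrite -(scal_comm (phi b) a%:P) addrA subrK.
by rewrite (scal_comm (phi b) (scal A (phi a))).
Qed.

(* The admissible elements form a commutative subalgebra, on which phi is
   multiplicative and injective. *)
Definition admissible c :=
  [/\ below s 0 c, c * f = f * c, c * g = g * c &
      exists a b, generic (pencil c) = a * generic (pencil f) + b * generic (pencil g)].

Lemma admissible_f : admissible f.
Proof. by split=> //; exists 1, 0; rewrite mul1r mul0r addr0. Qed.

Lemma admissible_g : admissible g.
Proof. by split=> //; exists 0, 1; rewrite mul1r mul0r add0r. Qed.

Lemma admissible1 : admissible 1.
Proof.
split; rewrite ?mul1r ?mulr1 //; first exact: below1.
by exists 0, 0; rewrite pencil1 rmorph0 !mul0r addr0.
Qed.

Lemma admissibleB a b : admissible a -> admissible b -> admissible (a - b).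
Proof.
move=> [Ba af ag [xa [ya ea]]] [Bb bf bg [xb [yb eb]]].
split; rewrite ?mulrBl ?mulrBr ?af ?ag ?bf ?bg //; first exact: belowB.
exists (xa - xb), (ya - yb); rewrite pencilB rmorphB /= ea eb.
by rewrite !mulrBl opprD addrACA.
Qed.

Lemma admissibleM a b : admissible a -> admissible b -> admissible (a * b).
Proof.
move=> [Ba af ag [xa [ya ea]]] [Bb bf bg [xb [yb eb]]].
split.
- exact: below_mul.
- by rewrite -mulrA bf !mulrA af.
- by rewrite -mulrA bg !mulrA ag.
exists (generic a%:P * xb + j (phi b) *: xa), (generic a%:P * yb + j (phi b) *: ya).
rewrite pencilM // rmorphD /= generic_scalM rmorphM /= ea eb.
by rewrite mulrDr scalerDr !scalerAl !mulrA addrACA -!mulrDl.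
Qed.

Lemma admissibleC x : admissible (x%:A).
Proof.
split; rewrite ?mulr_algl ?mulr_algr //.
  by move=> w; rewrite linearZ /=; have := @below1 d s _ A w; case: eqP => [->|_ H _];
    rewrite ?mulr0 ?eqxx //; apply: H.
by exists 0, 0; rewrite pencilZ pencil1 mulr0 rmorph0 !mul0r addr0.
Qed.

Lemma admissible0 : admissible 0.
Proof. by rewrite -(scale0r 1); apply: admissibleC. Qed.

Lemma admissibleD a b : admissible a -> admissible b -> admissible (a + b).
Proof.
by move=> Ca Cb; rewrite -[b]opprK -[- b]sub0r;
  apply/admissibleB/admissibleB => //; apply: admissible0.
Qed.

Lemma admissibleZ x a : admissible a -> admissible (x *: a).
Proof. by move=> Ca; rewrite -mulr_algl; apply/admissibleM/Ca/admissibleC. Qed.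

Lemma face_admissibleM a b : admissible a -> admissible b -> phi (a * b) = phi a * phi b.
Proof. by move=> [Ba _ _ _] [Bb _ _ _]; rewrite face_mul. Qed.

Lemma face_admissible_eq0 a : admissible a -> (j (phi a) == 0) = (a == 0).
Proof.
move=> [Ba _ ag _]; rewrite j_eq0 //; apply/eqP/eqP => [|->]; last exact: linear0.
exact: face_inj below_g face_g Ba ag.
Qed.

Lemma face_const x : phi x%:A = x%:P :> {poly k}.
Proof. by rewrite linearZ /= face1 alg_polyC. Qed.

(** The field of fractions, inside E, of the image under phi of the admissible elements. *)
Definition scalars (x : E) := exists a b,
  [/\ admissible a, admissible b, b != 0 & j (phi b) * x = j (phi a)].

Lemma scalars_face a : admissible a -> scalars (j (phi a)).
Proof.
move=> Ca; exists a, 1; split=> //; rewrite ?oner_neq0 //; first exact: admissible1.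
by rewrite face1 rmorph1 mul1r.
Qed.

Lemma scalars1 : scalars 1.
Proof. by have := scalars_face admissible1; rewrite face1 rmorph1. Qed.

Lemma scalarsC x : scalars (j x%:P).
Proof. by rewrite -face_const; apply/scalars_face/admissibleC. Qed.

Lemma scalarsB x y : scalars x -> scalars y -> scalars (x - y).
Proof.
move=> [a [b [Ca Cb b0 e]]] [a' [b' [Ca' Cb' b0' e']]].
exists (a * b' - b * a'), (b * b'); split.
- by apply: admissibleB; apply: admissibleM.
- exact: admissibleM.
- exact: fmulf_neq0.
by rewrite linearB /= !face_admissibleM // rmorphB !rmorphM /= -e -e'; ring.
Qed.

Lemma scalars0 : scalars 0.
Proof. by rewrite -(subrr 1); apply: scalarsB scalars1 scalars1. Qed.

Lemma scalarsM x y : scalars x -> scalars y -> scalars (x * y).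
Proof.
move=> [a [b [Ca Cb b0 e]]] [a' [b' [Ca' Cb' b0' e']]].
exists (a * a'), (b * b'); split; rewrite ?fmulf_neq0 //; try exact: admissibleM.
by rewrite !face_admissibleM // !rmorphM /= -e -e'; ring.
Qed.

Lemma scalarsV x : scalars x -> scalars x^-1.
Proof.
have [->|x0] := eqVneq x 0.
  by rewrite invr0.
move=> [a [b [Ca Cb b0 e]]]; exists b, a; split=> //; last by rewrite -e mulfK.
by rewrite -face_admissible_eq0 // -e mulf_eq0 negb_or x0 face_admissible_eq0 // b0.
Qed.

(* The graph of the map phi(c) a |-> a c, which is well defined by
   [related_eq0] and kills the left multiples of pencil f and pencil g. *)
Inductive related : AE -> A -> Prop :=
| related0 : related 0 0
| relatedS c a z y : admissible c -> related z y ->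
    related (j (phi c) *: generic a%:P + z) (a * c + y).

Lemma related1 c a : admissible c -> related (j (phi c) *: generic a%:P) (a * c).
Proof.
by move=> Cc; rewrite -[X in related X]addr0 -[X in related _ X]addr0; apply: relatedS related0.
Qed.

Lemma relatedD z y z' y' : related z y -> related z' y' -> related (z + z') (y + y').
Proof.
move=> r r'; elim: r => [|c a {}z {}y Cc _ IH]; first by rewrite !add0r.
by rewrite -!addrA; apply: relatedS.
Qed.

Lemma related_mull b z y : related z y -> related (generic b%:P * z) (b * y).
Proof.
elim=> [|c a {}z {}y Cc _ IH]; first by rewrite !mulr0; apply: related0.
rewrite !mulrDr -scalerAr -rmorphM -polyCM mulrA; exact: relatedS.
Qed.

Lemma related_scale b z y : admissible b -> related z y ->
  related (j (phi b) *: z) (y * b).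
Proof.
move=> Cb; elim=> [|c a {}z {}y Cc _ IH]; first by rewrite scaler0 mul0r; apply: related0.
rewrite scalerDr scalerA mulrC -rmorphM -face_admissibleM // mulrDl -mulrA.
by apply: relatedS => //; apply: admissibleM.
Qed.

(** The term phi(c) a h is sent to a h c and phi(h) phi(c) a = phi(c h) a to a c h, while c commutes
    with h. *)
Lemma related_pencil h z y : h = f \/ h = g -> related z y ->
  related (z * generic (pencil h)) 0.
Proof.
move=> hE; have Ch : admissible h by case: hE => ->; [apply: admissible_f|apply: admissible_g].
elim=> [|c a {}z {}y Cc _ IH]; first by rewrite mul0r; apply: related0.
have hc : c * h = h * c by case: Cc => _ cf cg _; case: hE => ->.
rewrite mulrDl -(addr0 (0 : A)); apply: relatedD => //.
have -> : 0 = a * h * c + a * (- (h * c)) :> A by rewrite mulrN mulrA subrr.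
rewrite /pencil rmorphB /= generic_scal mulrBr -!scalerAl -rmorphM -polyCM.
apply: relatedD; first exact: related1.
rewrite mulr_algr scalerA -scaleNr -(rmorphM j) -(rmorphN j) -hc.
rewrite [X in j X](_ : _ = phi (- (c * h))); last by rewrite raddfN /= face_admissibleM // mulrC.
by apply: related1; rewrite -scaleN1r; apply/admissibleZ/admissibleM.
Qed.

(** Collecting by words gives z = \sum_w phi(Y w) w and y = \sum_w w (Y w), so the injectivity of
    phi carries z = 0 over to y = 0. *)
Lemma related_expansion z y : related z y -> exists Y : seq 'I_d -> A,
  [/\ forall w, admissible (Y w), forall w, wcoef w z = j (phi (Y w)) &
      exists N0, forall N, (N0 <= N.+1)%N ->
        y = \sum_(w <- short_words d N) monomial A w * Y w].
Proof.
elim=> [|c a {}z {}y Cc _ [Y [CY zY [N0 yY]]]].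
  exists (fun=> 0); split=> [w|w|]; first exact: admissible0.
    by rewrite !linear0 rmorph0.
  by exists 0%N => N _; rewrite big1 // => w _; rewrite mulr0.
exists (fun w => wcoef w a *: c + Y w); split=> [w|w|].
- exact/admissibleD/CY/admissibleZ.
- rewrite [LHS]linearD linearZ /= zY wcoef_generic pwcoefC mulrC -rmorphM -rmorphD.
  by rewrite mul_polyC linearD linearZ.
exists (maxn (dg a) N0) => N; rewrite geq_max => /andP[aN yN].
rewrite (yY N yN) [in LHS](monomial_expansion aN) mulr_suml -big_split /=.
by apply: eq_bigr => w _; rewrite mulrDr -scalerAl -scalerAr.
Qed.

Lemma related_eq0 y : related 0 y -> y = 0.
Proof.
move=> /related_expansion[Y [CY zY [N0 yY]]].
rewrite (yY N0) // big1 // => w _; have /esym/eqP := zY w.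
by rewrite linear0 face_admissible_eq0 // => /eqP->; rewrite mulr0.
Qed.

Definition cleared z := exists b y,
  [/\ admissible b, b != 0 & related (j (phi b) *: z) y].

Lemma clearedD z z' : cleared z -> cleared z' -> cleared (z + z').
Proof.
move=> [b [y [Cb b0 r]]] [b' [y' [Cb' b0' r']]].
exists (b * b'), (y * b' + y' * b); split; rewrite ?fmulf_neq0 //; first exact: admissibleM.
rewrite face_admissibleM // rmorphM scalerDr -(scalerA _ _ z') mulrC -scalerA.
by apply: relatedD; apply: related_scale.
Qed.

Lemma scalars_cleared z : coeffs_in scalars z -> cleared z.
Proof.
elim: {z}(dg z) {-2}z (leqnn (dg z)) => [|n IHn] z le Sz.
  move: le; rewrite leqn0 dg_eq0 => /eqP->; exists 1, 0.
  by rewrite scaler0 oner_neq0; split=> //; [apply: admissible1|apply: related0].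
rewrite (trans_decomp z); apply: clearedD.
  have [a [b [Ca Cb b0 e]]] := Sz [::]; exists b, (1 * a); split=> //.
  by rewrite scalerA e; have := related1 1 Ca; rewrite polyC1 rmorph1.
elim/big_ind: _ => [||i _].
- exists 1, 0.
  by rewrite scaler0 oner_neq0; split=> //; [apply: admissible1|apply: related0].
- exact: clearedD.
have [//||b [y [Cb b0 r]]] := IHn (trans i z); first exact: dg_trans.
  by move=> w; rewrite -wcoef_cons.
exists b, (letter i * y); split=> //.
by rewrite scalerAr -(generic_letter A j AE); apply: related_mull.
Qed.

Definition killed z := exists b,
  [/\ admissible b, b != 0 & related (j (phi b) *: z) 0].

Lemma killedD z z' : killed z -> killed z' -> killed (z + z').
Proof.
move=> [b [Cb b0 r]] [b' [Cb' b0' r']].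
exists (b * b'); split; rewrite ?fmulf_neq0 //; first exact: admissibleM.
rewrite face_admissibleM // rmorphM scalerDr -(scalerA _ _ z') mulrC -scalerA.
have -> : 0 = 0 * b' + 0 * b :> A by rewrite !mul0r addr0.
by apply: relatedD; apply: related_scale.
Qed.

Lemma killed_pencil h z : h = f \/ h = g -> coeffs_in scalars z ->
  killed (z * generic (pencil h)).
Proof.
move=> hE /scalars_cleared[b [y [Cb b0 r]]]; exists b; split=> //.
by rewrite scalerAl; apply: related_pencil r.
Qed.

(** A denominator b would be the image of phi(b) and also 0. So the pencils of f and g generate a
    proper left ideal over [scalars]. *)
Lemma killed1 : ~ killed 1.
Proof.
move=> [b [Cb b0 r]]; case/eqP: b0; apply: related_eq0.
have := relatedD (related1 1 Cb) (related_scale (admissibleC (-1)) r).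
rewrite !mul1r mul0r addr0 polyC1 rmorph1 face_const polyCN polyC1 !rmorphN1.
by rewrite scaleN1r subrr.
Qed.


Lemma scalars_pencil h w : h = f \/ h = g -> scalars (wcoef w (generic (pencil h))).
Proof.
move=> hE; have Ch : admissible h by case: hE => ->; [apply: admissible_f|apply: admissible_g].
rewrite wcoef_generic raddfB rmorphB /= pwcoefC pwcoef_scal.
apply: scalarsB; first exact: scalarsC.
by case: ifP => _; [apply: scalars_face|rewrite rmorph0; apply: scalars0].
Qed.

Lemma pencil_g_neq0 : pencil g != 0.
Proof.
rewrite subr_eq0; apply: contraNneq face_g => /(congr1 (pwcoef [::])).
by rewrite pwcoefC pwcoef_scal wcoef_nil /= => ->.
Qed.

Lemma pencil_gcd : exists (w0 : seq 'I_d) (D : {poly A}),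
  [/\ w0 != [::], pwcoef w0 D = 1, dg (generic D) = (size w0).+1,
      forall w, scalars (j (pwcoef w D)) &
      forall c, admissible c -> exists Z, pencil c = Z * D].
Proof.
have gcd := @left_gcd_exists E d AE scalars scalars1 scalarsB scalarsM scalarsV
  (generic (pencil f)) (generic (pencil g)) (generic (pencil g)) (- generic (pencil f)).
(* The pencils commute because f and g do and tau is central; this is the relation that starts
   Euclid's algorithm. *)
have comm_fg : pencil g * pencil f = pencil f * pencil g.
  apply: commrB; last exact/commr_sym/scal_comm.
  apply/commr_sym/commrB; last exact/commr_sym/scal_comm.
  by rewrite /GRing.comm -!polyCM fg.
have Sf w : scalars (wcoef w (generic (pencil f))) by apply: scalars_pencil; left.
have Sg w : scalars (wcoef w (generic (pencil g))) by apply: scalars_pencil; right.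
have yg0 : generic (pencil g) != 0.
  apply: contra pencil_g_neq0 => /eqP e; apply/eqP/(generic_inj j_inj (AE := AE)).
  by rewrite e rmorph0.
have [||||||c [p [q [x [y [ep eq ec [Sc Sx Sy]]]]]]] := gcd.
- by [].
- by [].
- by [].
- by move=> w; rewrite linearN -sub0r; apply: scalarsB scalars0 (Sf w).
- by rewrite mulNr -!rmorphM /= comm_fg subrr.
- by left.
have c0 : c != 0 by apply: contraNneq yg0 => e; rewrite eq e mulr0.
have [w0 [cw0 dgc]] := dg_top c0.
have w0n : w0 != [::].
  apply/negP => /eqP e; rewrite e in cw0 dgc.
  have cE : c = (eps c)%:A by apply: dg_le1; rewrite dgc.
  apply: killed1.
  have -> : 1 = ((eps c)^-1 *: x) * generic (pencil f) + ((eps c)^-1 *: y) * generic (pencil g).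
    by rewrite -!scalerAl -scalerDr -ec {2}cE scalerA mulVf ?scale1r.
  apply: killedD; apply: killed_pencil; (try by [left|right]).
    by apply: coeffs_inZ => //; [apply: scalarsM|apply/scalarsV/(Sc [::])].
  by apply: coeffs_inZ => //; [apply: scalarsM|apply/scalarsV/(Sc [::])].
have [t [P [Q [t0 eP eQ ePQ]]]] := gauss j_inj j_frac pencil_g_neq0 eq.
have eQw w : j (pwcoef w Q) = t^-1 * wcoef w c by rewrite -(wcoef_generic j AE) -eQ linearZ.
(* In [pencil g] only the coefficient of the empty word can involve tau. At the top word of P Q the
   coefficient is therefore constant in tau, and so are its two factors. *)
have [r rE] : exists r, pwcoef w0 Q = r%:P.
  have P0 : generic P != 0.
    by apply: contraNneq yg0 => e; rewrite ePQ rmorphM /= e mul0r.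
  have [w1 [Pw1 dgP]] := dg_top P0.
  have : pwcoef (w1 ++ w0) (pencil g) = pwcoef w1 P * pwcoef w0 Q.
    apply: j_inj; rewrite rmorphM -!(wcoef_generic j AE) -wcoefM_top ?dgP //.
      by rewrite ePQ rmorphM.
    by rewrite -eQ dgZ // dgc.
  rewrite raddfB /= pwcoefC pwcoef_scal; case: eqP => [/(congr1 size)|_].
    by move/eqP; rewrite size_cat addn_eq0 andbC => /andP[/nilP/eqP]; rewrite (negPf w0n).
  rewrite subr0 => /(congr1 (fun p : {poly k} => size p)) e.
  have P10 : pwcoef w1 P != 0 by rewrite -(j_eq0 j_inj) -(wcoef_generic j AE).
  have Q0 : pwcoef w0 Q != 0 by rewrite -(j_eq0 j_inj) eQw mulf_neq0 ?invr_eq0.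
  exists (pwcoef w0 Q)`_0; apply: size1_polyC.
  have : (size (pwcoef w1 P * pwcoef w0 Q)%R <= 1)%N by rewrite -e size_polyC leq_b1.
  rewrite size_mul //; move: P10; rewrite -size_poly_gt0.
  by case: (size (pwcoef w1 P)) => // n _ /=; apply: leq_trans; apply: leq_addl.
have r0 : r != 0.
  by rewrite -polyC_eq0 -rE -(j_eq0 j_inj) eQw mulf_neq0 ?invr_eq0.
(* With coefficient 1 at w0, the coefficients of D are quotients of those of c and so remain in
   [scalars]. *)
pose D := scal A r^-1%:P * Q.
have Dw0 : pwcoef w0 D = 1 by rewrite pwcoef_scalM rE -polyCM mulVf.
have [u uE] : exists u, generic D = u *: c.
  by exists (j r^-1%:P * t^-1); rewrite generic_scalM -eQ scalerA.
have uV : u = (wcoef w0 c)^-1.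
  apply: (mulIf cw0); rewrite mulVf //; have := wcoef_generic j AE w0 D.
  by rewrite Dw0 rmorph1 uE linearZ.
have u0 : u != 0 by rewrite uV invr_eq0.
exists w0, D; split=> //.
- apply/eqP; rewrite eqn_leq uE dgZ ?dgc //= ltnNge; apply/negP => /wcoef_dg/eqP.
  by rewrite linearZ mulf_eq0 (negPf u0) (negPf cw0).
- move=> w; rewrite -(wcoef_generic j AE) uE linearZ uV.
  by apply: scalarsM; [apply: scalarsV|]; apply: Sc.
move=> h [_ _ _ [a [b eh]]]; have [->|h0] := eqVneq (pencil h) 0.
  by exists 0; rewrite mul0r.
have {}eh : generic (pencil h) = u^-1 *: (a * p + b * q) * generic D.
  by rewrite eh ep eq uE -scalerAl -scalerAr scalerA mulVf // scale1r mulrDl !mulrA.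
have [v [P' [Q' [v0 eP' eQ' ->]]]] := gauss j_inj j_frac h0 eh.
(* Q' is an E-multiple of D, and D has coefficient 1 at w0, so the factor is the polynomial
   [pwcoef w0 Q']. *)
exists (P' * scal A (pwcoef w0 Q')); rewrite -mulrA; congr (_ * _).
apply: (generic_inj j_inj (AE := AE)); rewrite generic_scalM -eQ'; congr (_ *: _).
by rewrite -(wcoef_generic j AE) -eQ' linearZ /= wcoef_generic Dw0 rmorph1 mulr1.
Qed.

Lemma size_scal p : size (scal A p) = size p.
Proof.
apply: size_map_inj_poly; last exact: rmorph0.
by move=> x y /(congr1 (@eps _ _ A)); rewrite /= !epsC.
Qed.

Lemma lead_coef_scal p : lead_coef (scal A p) = (lead_coef p)%:A.
Proof. by rewrite lead_coefE size_scal coef_map. Qed.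

Lemma small_multiple (Z D : {poly A}) : (size (Z * D)%R < size D)%N -> Z * D = 0.
Proof.
have [->|Z0] := eqVneq Z 0; first by rewrite mul0r.
have [->|D0] := eqVneq D 0; first by rewrite mulr0.
rewrite psize_mul // ltnNge; move: Z0; rewrite -size_poly_gt0.
by case: (size Z) => //= n _; rewrite leq_addl.
Qed.

Lemma size_mulC (P : {poly A}) a : (size (P * a%:P)%R <= size P)%N.
Proof.
apply: leq_trans (size_polyMleq _ _) _; rewrite -subn1 leq_subLR addnC leq_add2r.
by rewrite size_polyC leq_b1.
Qed.

Definition gens (h x : A) := exists P : {poly k}, x = (scal A P).[h].

Lemma gensC h x : gens h (x%:A).
Proof. by exists x%:P; rewrite scalC hornerC. Qed.

Lemma gensD h x y : gens h x -> gens h y -> gens h (x + y).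
Proof. by move=> [P ->] [Q ->]; exists (P + Q); rewrite rmorphD hornerD. Qed.

Lemma gensM h x : gens h x -> gens h (x * h).
Proof. by move=> [P ->]; exists (P * 'X); rewrite rmorphM /= scalX hornerMX. Qed.

(** This is the expansion of p in base H: modulo H - h the powers of H become powers of h, and h
    commutes with H - h, so it can be moved past the cofactor. *)
Lemma reduce_scal (H : {poly k}) h p : (1 < size H)%N ->
  exists (Z r : {poly A}), [/\ scal A p = Z * (scal A H - h%:P) + r,
    (size r < size H)%N & forall i, gens h r`_i].
Proof.
move=> H1; elim: {p}(size p) {-2}p (leqnn (size p)) => [|n IHn] p le.
  exists 0, 0; rewrite mul0r addr0 size_poly0 (ltnW H1).
  move: le; rewrite leqn0 size_poly_eq0 => /eqP->; rewrite rmorph0.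
  by split=> // i; rewrite coef0 -(scale0r 1); apply: gensC.
have H0 : H != 0 by rewrite -size_poly_gt0 ltnW.
have [|Z [r [eZ sr gr]]] := IHn (p %/ H).
  rewrite size_divp //; move: H1; case: (size H) => // -[|m] //= _.
  by rewrite leq_subLR (leq_trans le) // addSn ltnS leq_addl.
set D := scal A H - h%:P in eZ *.
have Dh : D * h%:P = h%:P * D.
  by rewrite mulrBl mulrBr (scal_comm H).
exists (scal A (p %/ H) + Z * h%:P), (r * h%:P + scal A (p %% H)); split.
- rewrite {1}(divp_eq p H) rmorphD rmorphM /= addrA; congr (_ + _).
  rewrite mulrDl -mulrA -Dh mulrA -addrA -mulrDl -eZ -mulrDr.
  by rewrite subrK.
- apply: leq_ltn_trans (size_polyD _ _) _; rewrite gtn_max size_scal ltn_modp H0 andbT.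
  exact: leq_ltn_trans (size_mulC _ _) sr.
- move=> i; rewrite coefD coefMC coef_map; apply: gensD; last exact: gensC.
  exact: gensM.
Qed.

Lemma pencil_generator : exists h, forall c, admissible c -> gens h c.
Proof.
have [w0 [D [w0n Dw0 dgD SD divD]]] := pencil_gcd.
have D0 : D != 0.
  by apply: contraNneq (oner_neq0 {poly k}) => e; rewrite -Dw0 e raddf0.
(* D is a right factor of [pencil g], whose leading coefficient in tau is a nonzero scalar because
   phi(g) is not constant; so the leading coefficient of D is invertible. *)
have leadD : (dg (lead_coef D) <= 1)%N.
  have [Q eQ] := divD g admissible_g.
  have Q0 : Q != 0 by apply: contraNneq pencil_g_neq0 => e; rewrite eQ e mul0r.
  have lead_g : lead_coef (pencil g) = (- lead_coef (phi g))%:A.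
    rewrite /pencil addrC lead_coefDl ?lead_coefN ?lead_coef_scal ?scaleNr //.
    rewrite size_polyN size_scal; apply: leq_ltn_trans size_face_g.
    by rewrite size_polyC leq_b1.
  have n0 : - lead_coef (phi g) != 0.
    by rewrite oppr_eq0 lead_coef_eq0 -size_poly_gt0 ltnW // size_face_g.
  have [|_ ->] // := @dg_unit _ _ _ ((- lead_coef (phi g))^-1 *: lead_coef Q) (lead_coef D).
  rewrite -scalerAl -lead_coef_proper_mul ?pmulf_neq0 // -eQ lead_g.
  by rewrite scalerA mulVf // scale1r.
have szD : (1 < size D)%N.
  rewrite ltnNge; apply/negP => le; have := size1_polyC le => e.
  have := leadD; rewrite e lead_coefC -(dg_genericC AE j_inj) -e dgD ltnS leqn0 size_eq0.
  by rewrite (negPf w0n).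
(* If p phi(b) = phi(a), then p b - a is a multiple of D of smaller degree in tau, hence zero. As a
   and b are free of tau, p is constant. *)
have small p : scalars (j p) -> (size p < size D)%N -> (size p <= 1)%N.
  move=> [a [b [Ca Cb b0]]]; rewrite -rmorphM => /j_inj e lt.
  have [Za eZa] := divD a Ca; have [Zb eZb] := divD b Cb.
  have e1 : scal A p * b%:P - a%:P = (scal A p * Zb - Za) * D.
    rewrite mulrBl -mulrA -eZa -eZb /pencil mulrBr -e rmorphM (scal_comm (phi b)).
    by rewrite opprB addrA subrK.
  have le : (size (scal A p * b%:P - a%:P)%R < size D)%N.
    apply: leq_ltn_trans (size_polyD _ _) _; rewrite gtn_max size_polyN.
    rewrite (leq_ltn_trans (size_mulC _ _)) ?size_scal //=.
    by apply: leq_ltn_trans szD; rewrite size_polyC leq_b1.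
  have /eqP : scal A p * b%:P - a%:P = 0 by rewrite e1 small_multiple // -e1.
  rewrite subr_eq0 => /eqP /(congr1 (fun P : {poly A} => size P)).
  have [-> _|p0] := eqVneq p 0; first by rewrite size_poly0.
  rewrite psize_mul ?scal_eq0 ?polyC_eq0 // size_scal !size_polyC b0 addn1 /= => ->.
  exact: leq_b1.
pose H := pwcoef [::] D; pose h := (eps D`_0)%:A - D`_0.
(* The leading coefficient of D being scalar, the coefficient of a nonempty word has smaller degree
   in tau than D, and [small] makes it constant. *)
have DE : D = scal A H - h%:P.
  apply: eq_pwcoef => w; rewrite raddfB /= pwcoef_scal pwcoefC.
  case: eqP => [->|/eqP wn]; first by rewrite wcoef_nil linearB /= epsC subrr subr0.
  rewrite sub0r -polyCN linearB /= opprB (@wcoef_dg _ _ _ _%:A); last first.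
    by rewrite (leq_trans (dgC _ _)) // lt0n size_eq0.
  rewrite subr0 -coef_pwcoef; apply: size1_polyC; apply: small => //.
  rewrite -(prednK (ltnW szD)) ltnS; apply/leq_sizeP => i.
  rewrite coef_pwcoef leq_eqVlt => /orP[/eqP<-|lt].
    by apply: wcoef_dg; rewrite -lead_coefE (leq_trans leadD) // lt0n size_eq0.
  by rewrite nth_default ?linear0 // -(prednK (ltnW szD)).
have szH : size H = size D.
  have -> : size H = size (D + h%:P)%R by rewrite DE subrK size_scal.
  by rewrite size_polyDl // (leq_ltn_trans _ szD) // size_polyC leq_b1.
exists h => c Cc; have [Z eZ] := divD c Cc.
(* Modulo D, c equals phi(c), which reduces to an r of smaller degree with coefficients in k[h].
   Then c - r is a multiple of D of too small a degree, so c is the constant coefficient of r. *)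
have [|Z' [r [eZ' sr gr]]] := @reduce_scal H h (phi c); first by rewrite szH.
rewrite -DE szH in eZ' sr.
have e : c%:P - r = (Z + Z') * D.
  by rewrite mulrDl -eZ /pencil eZ' opprD addrA addrAC subrK.
have /eqP : c%:P - r = 0.
  rewrite e small_multiple // -e; apply: leq_ltn_trans (size_polyD _ _) _.
  rewrite gtn_max size_polyN sr andbT.
  by apply: leq_ltn_trans szD; rewrite size_polyC leq_b1.
rewrite subr_eq0 => /eqP /(congr1 (fun P : {poly A} => P`_0)).
by rewrite coefC /= => ->.
Qed.

End Pencil.

Theorem bergman_centralizer (f g : A) : f * g = g * f -> (1 < dg f)%N ->
  exists h (P Q : {poly k}), f = (scal A P).[h] /\ g = (scal A Q).[h].
Proof.
move=> fg f1.
pose F (w : seq 'I_d) : rat := (digits w)%:R / ((radix d ^ size w)%:R - 1).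
pose ws := [seq w <- short_words d (dg f + dg g) |
  (w != [::]) && ((wcoef w f != 0) || (wcoef w g != 0))].
have wsP w : w != [::] -> (wcoef w f != 0) || (wcoef w g != 0) -> w \in ws.
  move=> wn fgw; rewrite mem_filter wn fgw mem_short_words // leqNgt.
  apply/negP => lt; case/orP: fgw => /eqP[]; apply: wcoef_dg;
    rewrite ltnW // (leq_ltn_trans _ lt) ?leq_addr ?leq_addl //.
have [|w0 w0s maxw] := @exists_max _ F ws.
  have [|w [fw e]] := @dg_top _ _ _ f; first by rewrite -dg_eq0 -lt0n ltnW.
  have : w \in ws by apply: wsP; [move: f1; rewrite e; case: (w)|rewrite fw].
  by case: (ws).
pose s := F w0.
have pos (w : seq 'I_d) : w != [::] -> 0 < (radix d ^ size w)%:R - 1 :> rat.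
  by rewrite subr_gt0 ltr1n -(expn0 (radix d)) ltn_exp2l // lt0n size_eq0.
have ex_le w : w != [::] -> (excess s w <= 0) = (F w <= s).
  by move=> wn; rewrite /excess subr_le0 ler_pdivrMr // pos.
have bel y : y = f \/ y = g -> below s 0 y.
  move=> yE w yw; have [->|wn] := eqVneq w [::]; first by rewrite excess_nil.
  rewrite ex_le //; apply/maxw/wsP => //.
  by case: yE yw => -> ->; rewrite ?orbT.
have w0n : w0 != [::] by move: w0s; rewrite mem_filter => /andP[/andP[]].
have ex0 : excess s w0 = 0.
  by rewrite /excess /s /F divfK ?subrr // gt_eqF // pos.
have bf : below s 0 f by apply: bel; left.
have bg : below s 0 g by apply: bel; right.
have face_n (y : A) : wcoef w0 y != 0 -> face s 0 y != (eps y)%:P.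
  apply: contraNneq => e; rewrite -(coef_face_word y ex0) e coefC.
  by rewrite size_eq0 (negPf w0n).
(* [pencil_generator] requires a nonconstant face of its second element, so f and g exchange roles
   when w0 occurs in f. *)
move: w0s; rewrite mem_filter => /andP[/andP[_ /orP[w0f|w0g]] _].
- have [h H] := pencil_generator (esym fg) bg bf (face_n _ w0f).
  have [[P ->] [Q ->]] := (H _ (admissible_g (esym fg) bf), H _ (admissible_f (esym fg) bg)).
  by exists h, P, Q.
- have [h H] := pencil_generator fg bf bg (face_n _ w0g).
  have [[P ->] [Q ->]] := (H _ (admissible_f fg bf), H _ (admissible_g fg bg)).
  by exists h, P, Q.
Qed.

End Bergman.

(** * The monoid algebra of words *)

Section MonoidAlgebra.
Variables (R : comNzRingType) (d : nat).
Implicit Types (w u v : seq 'I_d).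

Definition fmalg := {malg R[{fmonom 'I_d}]}.
HB.instance Definition _ := GRing.Lalgebra.on fmalg.

Implicit Types (g h : {malg R[{fmonom 'I_d}]}) (m : {fmonom 'I_d}).

Lemma malg_elim (P : {malg R[{fmonom 'I_d}]} -> Prop) :
  P 0 -> (forall g h, P g -> P h -> P (g + h)) -> (forall c w, P << c *g FMonom w >>) ->
  forall g, P g.
Proof.
move=> P0 PD PU g; rewrite (monalgE g); elim/big_ind: _ => // m _.
by rewrite -(fmK m); apply: PU.
Qed.

Definition malg_trans (i : 'I_d) g : {malg R[{fmonom 'I_d}]} :=
  [malg m in [fset FMonom (behead (fmonom_val m)) | m in msupp g]%fset => g@_(FMonom (i :: m))].

Lemma mcoeff_trans i g w : (malg_trans i g)@_(FMonom w) = g@_(FMonom (i :: w)).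
Proof.
rewrite mcoeffE; case: ifPn => // nin; apply/esym/eqP; apply: contraR nin.
rewrite mcoeff_neq0 => gi.
by apply/imfsetP; exists (FMonom (i :: w)).
Qed.

Lemma eq_mcoeff g h : (forall w, g@_(FMonom w) = h@_(FMonom w)) -> g = h.
Proof. by move=> H; apply/malgP => m; rewrite -(fmK m). Qed.

Lemma mul_fmonom u v : mmul (FMonom u) (FMonom v) = FMonom (u ++ v).
Proof. by apply/eqP; rewrite fmP fmM. Qed.

Lemma one_fmonom : mone = FMonom [::] :> {fmonom 'I_d}.
Proof. by apply/eqP; rewrite fmP fm1. Qed.

Lemma malg_trans_add i g h : malg_trans i (g + h) = malg_trans i g + malg_trans i h.
Proof.
by apply: eq_mcoeff => w; rewrite mcoeffD !mcoeff_trans mcoeffD.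
Qed.

Lemma malg_transU i c w : malg_trans i << c *g FMonom w >> =
  if w is l :: w' then << c *+ (i == l) *g FMonom w' >> else 0.
Proof.
apply: eq_mcoeff => u; rewrite mcoeff_trans mcoeffU fmP /=.
case: w => [|l w]; first by rewrite mcoeff0.
by rewrite mcoeffU fmP /= eqseq_cons eq_sym -mulrnA mulnb.
Qed.

Lemma malg_trans0 i : malg_trans i 0 = 0.
Proof. by apply: eq_mcoeff => w; rewrite mcoeff_trans !mcoeff0. Qed.

(** Both sides are additive in g and in h, so it is enough to compare monomials. *)
Lemma mcoeff_fgmul_cons i w g h : (fgmul g h)@_(FMonom (i :: w)) =
  (fgmul (malg_trans i g) h)@_(FMonom w) + g@_(FMonom [::]) * h@_(FMonom (i :: w)).
Proof.
move: g h; apply: malg_elim => [h|g g' IHg IHg' h|c u].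
- by rewrite malg_trans0 !fgmul0g !mcoeff0 mul0r addr0.
- rewrite fgmulgDl malg_trans_add fgmulgDl.
  apply: etrans (mcoeffD _ _ _) _; apply: etrans (f_equal2 +%R (IHg h) (IHg' h)) _.
  apply: etrans (addrACA _ _ _ _) _; apply: f_equal2; first exact/esym/mcoeffD.
  by rewrite mcoeffD (@mulrDl R).
apply: malg_elim => [|h h' IHh IHh'|c' v].
- by rewrite !fgmulg0 !mcoeff0 mulr0 addr0.
- rewrite !fgmulgDr.
  apply: etrans (mcoeffD _ _ _) _; apply: etrans (f_equal2 +%R IHh IHh') _.
  apply: etrans (addrACA _ _ _ _) _; apply: f_equal2; first exact/esym/mcoeffD.
  by rewrite mcoeffD (@mulrDr R).
rewrite malg_transU fgmulUU mul_fmonom !mcoeffU !fmP /=.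
case: u => [|l u] /=; first by rewrite fgmul0g mcoeff0 add0r mulr1n mulrnAr.
rewrite fgmulUU mul_fmonom mcoeffU fmP /= mulr0n mul0r addr0 eqseq_cons.
by rewrite eq_sym mulrnAl -mulrnA mulnb.
Qed.

Lemma mcoeffM_cons i w g h : (g * h)@_(FMonom (i :: w)) =
  (malg_trans i g * h)@_(FMonom w) + g@_(FMonom [::]) * h@_(FMonom (i :: w)).
Proof. exact: mcoeff_fgmul_cons. Qed.

Lemma mcoeffM_nil g h : (g * h)@_(FMonom [::]) = g@_(FMonom [::]) * h@_(FMonom [::]).
Proof. by rewrite -one_fmonom; apply: (rmorphM (mcoeff mone)). Qed.

Lemma mcoeff_scalerAr c g h : c *: (g * h) = g * (c *: h).
Proof.
apply: eq_mcoeff => w; apply: etrans (mcoeffZ _ _ _) _; elim: w g => [|i w IHw] g.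
  apply: etrans (congr1 ( *%R c) (mcoeffM_nil g h)) _.
  apply/esym/(etrans (mcoeffM_nil g (c *: h))).
  by rewrite mcoeffZ (@mulrCA R).
apply: etrans (congr1 ( *%R c) (mcoeffM_cons i w g h)) _.
apply/esym/(etrans (mcoeffM_cons i w g (c *: h))).
by rewrite mcoeffZ (@mulrDr R) IHw (@mulrCA R).
Qed.

Fact malg_scalerAr (c : R) (g h : fmalg) : c *: (g * h) = g * (c *: h).
Proof. exact: mcoeff_scalerAr. Qed.
HB.instance Definition _ := GRing.Lalgebra_isAlgebra.Build R fmalg malg_scalerAr.

Fact mcoeff_is_linear : linear_for *%R (mcoeff (FMonom [::]) : fmalg -> R).
Proof. by move=> c g h; rewrite mcoeffD mcoeffZ. Qed.

Fact mcoeff_is_multiplicative : monoid_morphism (mcoeff (FMonom [::]) : fmalg -> R).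
Proof.
rewrite -one_fmonom; split; first by rewrite rmorph1.
by move=> g h; rewrite rmorphM.
Qed.

Fact malg_trans_is_linear i : linear (malg_trans i : fmalg -> fmalg).
Proof.
move=> c g h; apply: eq_mcoeff => w.
by rewrite mcoeffD mcoeffZ !mcoeff_trans mcoeffD mcoeffZ.
Qed.

Fact mcoeff_letter i : (<< FMonom [:: i] >> : fmalg)@_(FMonom [::]) = 0.
Proof. by rewrite mcoeffU1 fmP. Qed.

Fact malg_trans_letter i l : malg_trans i (<< FMonom [:: l] >> : fmalg) = (l == i)%:R.
Proof.
rewrite malg_transU -one_fmonom eq_sym; case: eqP => _ //.
by rewrite mulr0n monalgU0.
Qed.

Fact malg_transM i (g h : fmalg) :
  malg_trans i (g * h) = malg_trans i g * h + g@_(FMonom [::]) *: malg_trans i h.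
Proof.
apply: eq_mcoeff => w; rewrite mcoeffD mcoeffZ !mcoeff_trans.
exact: mcoeffM_cons.
Qed.

Fact malg_trans_decomp (g : fmalg) :
  g = (g@_(FMonom [::]))%:A + \sum_i << FMonom [:: i] >> * malg_trans i g.
Proof.
apply: eq_mcoeff => -[|i w].
  rewrite mcoeffD mcoeffZ mcoeff1 -one_fmonom eqxx mulr1 raddf_sum big1 ?addr0 // => i _.
  by rewrite [LHS]rmorphM /= one_fmonom mcoeff_letter mul0r.
rewrite mcoeffD mcoeffZ mcoeff1 fmP fm1 mulr0 add0r raddf_sum /= (bigD1 i) //= big1 => [|l li].
  rewrite mcoeffM_cons mcoeff_letter mul0r !addr0 malg_trans_letter eqxx.
  by rewrite (mul1r (malg_trans i g)) mcoeff_trans.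
rewrite mcoeffM_cons mcoeff_letter mul0r addr0 malg_trans_letter (negbTE li).
by rewrite (mul0r (malg_trans l g)) mcoeff0.
Qed.

Fact malg_trans_nilpotent (g : fmalg) : exists N,
  forall w, (N <= size w)%N -> foldl (fun y i => malg_trans i y) g w = 0.
Proof.
have coefE w u (h : fmalg) :
    (foldl (fun y i => malg_trans i y) h w)@_(FMonom u) = h@_(FMonom (w ++ u)).
  by elim: w h => //= i w IHw h; rewrite IHw mcoeff_trans.
exists (\max_(m <- msupp g) (size (m : seq 'I_d)).+1)%N => w le.
apply: eq_mcoeff => u; rewrite coefE mcoeff0; apply: mcoeff_outdom; apply/negP => gwu.
have := @leq_bigmax_seq _ (enum_fset (msupp g)) xpredT
  (fun m : {fmonom 'I_d} => (size (m : seq 'I_d)).+1) _ gwu isT.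
by rewrite /= size_cat => /leq_trans/(_ le); rewrite ltnNge leq_addr.
Qed.

HB.instance Definition _ := Algebra_isFree.Build R d fmalg mcoeff_is_linear
  mcoeff_is_multiplicative malg_trans_is_linear mcoeff_letter malg_trans_letter
  malg_transM malg_trans_decomp malg_trans_nilpotent.

Lemma wcoef_fmalg w (g : fmalg) : wcoef w g = g@_(FMonom w).
Proof.
by elim: w g => [|i w IHw] g; rewrite ?wcoef_nil // wcoef_cons IHw -mcoeff_trans.
Qed.

End MonoidAlgebra.

Local Open Scope classical_set_scope.
Local Open Scope ring_scope.

Lemma fraction_numden (R : idomainType) (x : {fraction R}) :
  exists p s, s != 0 /\ tofrac s * x = tofrac p.
Proof.
elim/quotW: x => x; exists (frac x).1, (frac x).2; split; first exact: denom_ratioP.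
unlock tofrac; rewrite -[LHS]FracField.pi_mul.
apply/eqP; rewrite FracField.equivf_def /FracField.mulf.
by rewrite !numden_Ratio ?mul1r ?mulr1 ?oner_eq0 ?denom_ratioP.
Qed.

Lemma tofrac_inj (R : idomainType) : injective (@tofrac R).
Proof. by move=> x y /eqP; rewrite tofrac_eq => /eqP. Qed.

(** * The four conditions *)

Section Evaluation.
Variables (k : fieldType) (d : nat) (A : freeAlgType k d).
Implicit Types (h x y z : A) (p q : {poly k}).

Lemma scal_hornerS p (c : k) h : (scal A (p * 'X + c%:P)).[h] = (scal A p).[h] * h + c%:A.
Proof. by rewrite rmorphD rmorphM /= scalX scalC hornerD hornerMX hornerC. Qed.

Lemma scal_horner_comm p h : GRing.comm h (scal A p).[h].
Proof.
elim/poly_ind: p => [|p c IHp]; first by rewrite rmorph0 horner0; apply: commr0.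
rewrite scal_hornerS; apply: commrD; first exact/commrM.
by rewrite /GRing.comm mulr_algl mulr_algr.
Qed.

Lemma scal_hornerM p q h : (scal A (p * q)).[h] = (scal A p).[h] * (scal A q).[h].
Proof. by rewrite rmorphM hornerM_comm //; apply: scal_horner_comm. Qed.

Lemma gens_linear c x y z : gens x y -> gens x z -> gens x (c *: y + z).
Proof.
move=> [P ->] [Q ->]; exists (c%:P * P + Q).
by rewrite rmorphD hornerD scal_hornerM scalC hornerC mulr_algl.
Qed.

Lemma gens_mul x y z : gens x y -> gens x z -> gens x (y * z).
Proof. by move=> [P ->] [Q ->]; exists (P * Q); rewrite scal_hornerM. Qed.

Lemma gens_trans x y z : gens x y -> gens y z -> gens x z.
Proof.
move=> [P ->] [Q ->]; exists (Q \Po P); elim/poly_ind: Q => [|Q c IHQ].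
  by rewrite comp_poly0 !rmorph0 !horner0.
rewrite scal_hornerS IHQ comp_polyD comp_polyM comp_polyX comp_polyC.
by rewrite rmorphD /= hornerD scal_hornerM scalC hornerC.
Qed.

Lemma gens_comm x y : gens x y -> GRing.comm x y.
Proof. by move=> [P ->]; apply: scal_horner_comm. Qed.

(** In Horner's scheme q(h) h + c is not constant when q is nonzero, as q(h) h has at least the
    degree of h. *)
Lemma dg_horner p h : (1 < dg h)%N -> p != 0 ->
  (scal A p).[h] != 0 /\ ((1 < size p)%N -> (1 < dg (scal A p).[h])%N).
Proof.
move=> h1; elim/poly_ind: p => [|p c IHp]; first by rewrite eqxx.
have [->|p0] := eqVneq p 0.
  rewrite mul0r add0r polyC_eq0 scalC hornerC => c0; split.
    by rewrite fscale_eq0 negb_or c0 oner_neq0.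
  by rewrite size_polyC c0.
move=> _; have [ph0 _] := IHp p0.
have dgph : (1 < dg (scal A (p * 'X + c%:P)).[h])%N.
  rewrite ltnNge; apply/negP => le; have : (dg ((scal A p).[h] * h) <= 1)%N.
    rewrite -(addrK c%:A (_ * h)) -scal_hornerS; apply: dgB => //; exact: dgC.
  have h0 : h != 0 by rewrite -dg_eq0 -lt0n ltnW.
  by rewrite dgM_eq // leqNgt (leq_trans h1) // leq_addl.
by split=> // ; rewrite -dg_eq0 -lt0n ltnW.
Qed.

End Evaluation.

Lemma base_change_horner (k L : fieldType) (iota : {rmorphism k -> L}) (d : nat)
    (A : freeAlgType k d) (A' : freeAlgType L d) p (h : A) :
  base_change iota A' (scal A p).[h] = (scal A' (map_poly iota p)).[base_change iota A' h].
Proof.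
elim/poly_ind: p => [|p c IHp]; first by rewrite !(horner0, rmorph0).
have -> : map_poly iota (p * 'X + c%:P) = map_poly iota p * 'X + (iota c)%:P.
  by rewrite rmorphD rmorphM /= map_polyX map_polyC.
by rewrite !scal_hornerS -IHp rmorphD rmorphM /= base_changeC.
Qed.

Section Criteria.
Variables (k : fieldType) (d : nat) (A : freeAlgType k d).
Variables (E : fieldType) (j : {rmorphism {poly k} -> E}) (AE : freeAlgType E d).
Hypothesis j_inj : injective j.
Hypothesis j_frac : forall x, exists p s, s != 0 /\ j s * x = j p.
Variable f : A.
Hypothesis f_deg : (1 < dg f)%N.

(** Removing the constant term of f translates the set of lambda by [iota (eps f)] and changes
    neither k[f] nor the centralizer. *)
Lemma infinite_factors_centralizer (L : fieldType) (iota : {rmorphism k -> L})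
    (A' : freeAlgType L d) :
  infinite_set [set lambda : L | exists a c : A',
    [/\ fiber (base_change iota A' f) lambda = a * c, (1 < dg a)%N & (1 < dg c)%N]] ->
  exists g, GRing.comm f g /\ ~ gens f g.
Proof.
move=> inf; set f0 := f - (eps f)%:A.
have eps_f0 : eps f0 = 0 by rewrite linearB /= epsC subrr.
have dg_f0 : (1 < dg f0)%N.
  rewrite ltnNge; apply/negP => le; move: f_deg; rewrite -(subrK (eps f)%:A f).
  by rewrite ltnNge dgD //; apply: dgC.
have gf0 : gens f0 f.
  exists ('X + (eps f)%:P).
  by rewrite -['X]mul1r scal_hornerS rmorph1 hornerC mul1r subrK.
have [|g [fg ng]] := infinite_factor_centralizer AE (A' := A') (iota := iota)
  j_inj j_frac eps_f0 dg_f0.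
  apply: contra_not inf => fin.
  apply: (sub_finite_set _ (finite_image (fun lambda => lambda + iota (eps f)) fin)).
  move=> lambda [a [c [e a1 c1]]]; exists (lambda - iota (eps f)); last by rewrite subrK.
  exists a, c; split=> //; rewrite -e /fiber rmorphB /= base_changeC.
  by rewrite scalerBl opprB addrA subrK.
exists g; split.
  rewrite -(subrK (eps f)%:A f); apply/commr_sym/commrD; first exact/commr_sym.
  by rewrite /GRing.comm mulr_algl mulr_algr.
by move=> gg; have [p e] := gens_trans gf0 gg; case: (ng p).
Qed.

(** By Bergman's theorem f = P(h) and g = Q(h). If P had degree one, h and hence g would be
    polynomials in f. *)
Lemma centralizer_composite g : GRing.comm f g -> ~ gens f g ->
  exists h (p : {poly k}), (2 < size p)%N /\ f = (scal A p).[h].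
Proof.
move=> fg ng.
have [h [P [Q [eP eQ]]]] := bergman_centralizer AE j_inj j_frac fg f_deg.
exists h, P; split=> //; rewrite ltnNge; apply/negP => le; apply: ng.
apply: (@gens_trans _ _ _ _ h); last by exists Q.
have [p0 [p1 PE]] : exists p0 p1, P = p1%:P * 'X + p0%:P.
  exists P`_0, P`_1; apply/polyP => i; rewrite coefD coefMX !coefC.
  case: i => [|[|i]]; rewrite ?addr0 ?add0r //=.
  by rewrite nth_default // (leq_trans le).
have p1n : p1 != 0.
  apply: contraTneq f_deg => p10; rewrite -leqNgt eP PE p10 mul0r add0r scalC hornerC.
  exact: dgC.
exists (p1^-1%:P * 'X + (- (p1^-1 * p0))%:P).
rewrite scal_hornerS scalC hornerC mulr_algl eP PE scal_hornerS scalC hornerC mulr_algl.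
by rewrite scalerDr !scalerA mulVf // scale1r scaleNr addrK.
Qed.

Lemma composite_factors (L : closedFieldType) (iota : {rmorphism k -> L})
    (A' : freeAlgType L d) h (p : {poly k}) : (2 < size p)%N -> f = (scal A p).[h] ->
  forall lambda : L, exists a c : A',
    [/\ fiber (base_change iota A' f) lambda = a * c, (1 < dg a)%N & (1 < dg c)%N].
Proof.
move=> p2 e lambda.
have h1 : (1 < dg h)%N.
  rewrite ltnNge; apply/negP => /dg_le1 eh; move: f_deg; rewrite e eh ltnNge => /negP[].
  elim/poly_ind: p {p2 e} => [|p c IHp]; first by rewrite rmorph0 horner0 dg0.
  rewrite scal_hornerS mulr_algr; apply: dgD; [exact: dgZ|exact: dgC].
set P := map_poly iota p - lambda%:P.
have szP : size P = size p.
  rewrite /P size_polyDl size_map_poly // size_polyN size_polyC.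
  by rewrite (leq_ltn_trans (leq_b1 _)) // ltnW.
have [|r /factor_theorem[q eq]] := @closed_rootP L P _.
  by rewrite szP; case: (size p) p2 => [|[|n]].
have P0 : P != 0 by rewrite -size_poly_eq0 szP -lt0n ltnW // ltnW.
have q0 : q != 0 by apply: contraNneq P0 => q0; rewrite eq q0 mul0r.
have q1 : (1 < size q)%N.
  by move: p2; rewrite -szP eq size_Mmonic ?monicXsubC // size_XsubC addn2.
set H := base_change iota A' h.
have H1 : (1 < dg H)%N by rewrite dg_base_change //; apply: fmorph_inj.
exists (scal A' q).[H], (scal A' ('X - r%:P)).[H]; split.
- rewrite -scal_hornerM -eq /P rmorphB /= hornerD hornerN scalC hornerC.
  by rewrite -base_change_horner -e.
- by have [_ ->] := dg_horner H1 q0.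
- have [|_ ->] := @dg_horner _ _ A' ('X - r%:P) H H1 => //.
    by rewrite -size_poly_gt0 size_XsubC.
  by rewrite size_XsubC.
Qed.

End Criteria.

Lemma closed_field_infinite (L : closedFieldType) : infinite_set [set: L].
Proof.
move=> /finite_seqP[s sE].
have [|x] := @closed_nonrootP L (\prod_(a <- s) ('X - a%:P)) _.
  by rewrite monic_neq0 // monic_prod_XsubC.
rewrite root_prod_XsubC => /negP[]; have : [set: L] x by [].
by rewrite sE.
Qed.

Section FreeAlg.
Variables (K : fieldType) (d : nat).
Local Notation A := (fmalg K d).

Lemma malgC_alg (c : K) : c%:MP = (c%:A : A).
Proof. by rewrite -mul_malgC; apply/esym/(mulr1 _). Qed.

Lemma nonconstantP (g : A) : nonconstant g <-> (1 < dg g)%N.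
Proof.
split=> [H|lt [c]].
  rewrite ltnNge; apply/negP => /dg_le1 e; apply: H; exists (eps g).
  by rewrite malgC_alg.
by rewrite malgC_alg => e; have := dgC A c; rewrite -e leqNgt lt.
Qed.

Lemma factorsP (g : A) : factors g <->
  exists a c : A, [/\ g = a * c, (1 < dg a)%N & (1 < dg c)%N].
Proof.
by split=> -[a [c [H1 H2 H3]]]; exists a, c; split=> //; apply/nonconstantP.
Qed.

Lemma generated_subalgP (f g : A) : generated_subalg f g <-> gens f g.
Proof.
split=> [H|[P ->] S [Scl Sf]].
  apply: H; split; last by move=> _ ->; exists 'X; rewrite scalX hornerX.
  split; first by rewrite inE; have := gensC f 1; rewrite scale1r.
    by move=> c x y; rewrite !inE; apply: gens_linear.
  by move=> x y; rewrite !inE; apply: gens_mul.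
case: Scl => S1 Slin SM; have S0 : 0 \in S.
  by have := Slin (-1) 1 1 S1 S1; rewrite scaleN1r addNr.
suff : (scal A P).[f] \in S by rewrite inE.
have {}Sf : f \in S by rewrite inE; apply: Sf.
elim/poly_ind: P => [|P c IHP]; first by rewrite rmorph0 horner0.
rewrite scal_hornerS addrC; apply: Slin => //; exact: SM.
Qed.

Lemma proper_centralizerP (f : A) : generated_subalg f `<` centralizer f <->
  exists g, GRing.comm f g /\ ~ gens f g.
Proof.
split=> [[_ H]|[g [fg ng]]].
  apply: contrapT => H'; apply: H => g fg.
  apply: (proj2 (generated_subalgP f g)); apply: contrapT => ng.
  exact: H' (ex_intro _ g (conj fg ng)).
split=> [x /generated_subalgP|H]; first exact: gens_comm.
exact: ng (proj1 (generated_subalgP f g) (H g fg)).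
Qed.

End FreeAlg.

Lemma map_malgE (K L : fieldType) (d : nat) (iota : {rmorphism K -> L}) (f : fmalg K d) :
  map_malg iota f = base_change iota (fmalg L d) f.
Proof.
apply: eq_mcoeff => w; rewrite mcoeff_map_malg.
by rewrite -(wcoef_fmalg _ (base_change iota (fmalg L d) f)) wcoef_base_change wcoef_fmalg.
Qed.

Theorem theorem3p2 (k : fieldType) (kbar : closedFieldType)
    (iota : {rmorphism k -> kbar}) (kbar_alg : algebraic_extension iota)
    (d : nat) (f : freealg k d) (f_nonconst : nonconstant f) :
  [<-> infinite_set [set lambda : kbar | factors (map_malg iota f - lambda%:MP)];
       forall lambda : kbar, factors (map_malg iota f - lambda%:MP);
       generated_subalg f `<` centralizer f;
       composite f].
Proof.
have f1 : (1 < dg (f : fmalg k d))%N by apply/nonconstantP.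
have factE lambda : factors (map_malg iota f - lambda%:MP) <->
    exists a c : fmalg kbar d,
      [/\ fiber (base_change iota (fmalg kbar d) (f : fmalg k d)) lambda = a * c,
         (1 < dg a)%N & (1 < dg c)%N].
  by rewrite map_malgE malgC_alg; apply: factorsP.
have t_inj := @tofrac_inj {poly k}; have t_frac := @fraction_numden {poly k}.
pose AE := fmalg {fraction {poly k}} d.
have infE : infinite_set [set lambda : kbar | factors (map_malg iota f - lambda%:MP)] ->
    generated_subalg f `<` centralizer f.
  move=> inf; apply: (proj2 (proper_centralizerP f)).
  apply: (@infinite_factors_centralizer _ _ (fmalg k d) _ _ AE t_inj t_frac f f1 _ iota
    (fmalg kbar d)).
  by apply: sub_infinite_set inf => lambda /factE.
have compE : generated_subalg f `<` centralizer f -> composite f.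
  move=> /(proj1 (proper_centralizerP f))[g [fg ng]].
  exact: (@centralizer_composite _ _ (fmalg k d) _ _ AE t_inj t_frac f f1 g fg ng).
have allE : composite f -> forall lambda : kbar, factors (map_malg iota f - lambda%:MP).
  move=> [h [p [p2 e]]] lambda; apply: (proj2 (factE lambda)).
  refine (@composite_factors _ _ (fmalg k d) f f1 _ iota (fmalg kbar d) h p p2 e lambda).
have all_inf : (forall lambda : kbar, factors (map_malg iota f - lambda%:MP)) ->
    infinite_set [set lambda : kbar | factors (map_malg iota f - lambda%:MP)].
  by move=> H; apply: sub_infinite_set (@closed_field_infinite kbar) => lambda _; apply: H.
tfae=> [inf|all|proper|comp].
- exact: allE (compE (infE inf)).
- exact: infE (all_inf all).
- exact: compE.
- exact: all_inf (allE comp).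
Qed.
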